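(* Let $n \ge 0$, let $a_1,\dots,a_n \in \mathbb{C}$ be distinct points, and let $X = \mathbb{C}\setminus\{a_1,\dots,a_n\}$. Then: (1) The null homotopy class of continuous maps $X \to \mathbb{C}\times\mathbb{C}^*$ (the class of the constant maps) contains a proper holomorphic immersion that identifies at most countably many pairs of distinct points in $X$. (2) Every non-null homotopy class of continuous maps $X \to \mathbb{C}\times\mathbb{C}^*$ contains a proper holomorphic immersion that identifies at most finitely many pairs of distinct points in $X$.
   Context: $\mathbb{C}^* = \mathbb{C}\setminus\{0\}$. A map $\psi$ identifies a pair of distinct points $x \neq y$ if $\psi(x)=\psi(y)$; ''at most countably (finitely) many pairs'' means that the set of pairs $\{x,y\}$ with $x\ne y$ and $\psi(x)=\psi(y)$ is at most countable (finite). *)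

(* Defs.v *)
From mathcomp Require Export all_boot all_order all_algebra.
From mathcomp Require Export complex.
From mathcomp Require Export all_classical all_reals all_analysis.
Export Order.TTheory GRing.Theory Num.Theory.
Export numFieldNormedType.Exports.
Set Implicit Arguments.
Unset Strict Implicit.
Unset Printing Implicit Defensive.
Local Open Scope classical_set_scope.
Local Open Scope ring_scope.

(* R[i] itself carries no topology in the libraries; its regular module R[i]^o
   is a normed module over R[i], with the usual topology. *)
Notation Cplx R := (R[i]^o) (only parsing).

(* A map from a subset X to a subset Y of the ambient spaces is represented by
   a total function of which only the restriction to X is relevant. Subsets
   carry the subspace topology. *)
Definition continuous_map (T U : topologicalType) (X : set T) (Y : set U)
    (f : T -> U) : Prop :=
  {within X, continuous f} /\ set_fun X Y f.

Definition homotopic (R : realType) (T U : topologicalType) (X : set T)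
    (Y : set U) (f g : T -> U) : Prop :=
  exists H : R * T -> U,
    [/\ @continuous_map (R * T)%type U ([set` `[0, 1]] `*` X) Y H,
        forall x, X x -> H (0, x) = f x &
        forall x, X x -> H (1, x) = g x].

Definition homotopy_class (R : realType) (T U : topologicalType) (X : set T)
    (Y : set U) (f : T -> U) : set (T -> U) :=
  [set g | homotopic R X Y f g].

(* When Y is path connected, this is a single homotopy class. *)
Definition null_homotopy_class (R : realType) (T U : topologicalType)
    (X : set T) (Y : set U) : set (T -> U) :=
  [set g | exists2 c, Y c & homotopy_class R X Y (cst c) g].

Definition proper_map (T U : topologicalType) (X : set T) (Y : set U)
    (f : T -> U) : Prop :=
  continuous_map X Y f /\
  forall K : set U, K `<=` Y -> compact K -> compact (X `&` f @^-1` K).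

(* For open X. Since the modules are normed over R[i], differentiability here
   is complex differentiability and 'd f x is complex linear. *)
Definition holomorphic_on (R : realType) (V W : normedModType R[i])
    (X : set V) (f : V -> W) : Prop :=
  forall x, X x -> differentiable f x.

Definition holomorphic_immersion_on (R : realType) (V W : normedModType R[i])
    (X : set V) (f : V -> W) : Prop :=
  holomorphic_on X f /\ forall x, X x -> injective ('d f x).

Definition proper_holomorphic_immersion (R : realType)
    (V W : normedModType R[i]) (X : set V) (Y : set W) (f : V -> W) : Prop :=
  proper_map X Y f /\ holomorphic_immersion_on X f.

(* The unordered pairs {x, y} of distinct points of X identified by f. *)
Definition identified_pairs (T U : Type) (X : set T) (f : T -> U) :
    set (set T) :=
  [set P | exists x y, [/\ X x, X y, x <> y, f x = f y & P = [set x; y]]].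

Definition punctured_plane (R : realType) (n : nat) (a : 'I_n -> Cplx R) :
    set (Cplx R) :=
  [set z | forall i, z <> a i].

(* C x C^* *)
Definition CxCstar (R : realType) : set (Cplx R * Cplx R) :=
  [set w | w.2 != 0].
Arguments CxCstar R : clear implicits.

(* Main.v *)
Require Import Defs.
From mathcomp Require Import ring lra zify.
Set Implicit Arguments.
Unset Strict Implicit.
Unset Printing Implicit Defensive.
Local Open Scope classical_set_scope.
Local Open Scope ring_scope.

(* Let q = \prod_i ('X - a_i). The null class contains (z + 1/q, e^z): an
   identified pair is {x, x + 2 i pi m} with m <> 0, and for each m the point x
   is a root of a nonzero polynomial.

   By induction on the number of punctures, every nonvanishing continuous
   function h on X is homotopic to some r = \prod_i (z - a_i)^k_i: after a
   radial homotopy, h only depends on the angle near a_i, hence has there the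
   form (z - a_i)^k e^g with g defined on the whole of C \ {a_i}; dividing by
   this form allows h to be extended over a_i. In a non-null class, r is not
   constant, and the representative is (P/q, r) with
   P = ('X - x0) ('X - w)^n for generic w and x0. The first component has poles
   at all the punctures and at infinity, whence properness. The fibre through
   x0 is {x0}, so the resultant of the equations of the double points is not
   identically zero, which leaves finitely many of them. *)

(** * Topology of the complex plane *)

Section ComplexTopology.
Local Open Scope complex_scope.
Variable R : realType.
Local Notation C := (R[i]^o).

(** Since C is contractible, the homotopy class only sees the second component, a unit on X, and the
    first component is free to be chosen. Immersivity is then at stake only at the critical points
    of r, which are finite in number because the Wronskian of its numerator and denominator is
    nonzero. At such a point the numerator of (P/Q)' is, up to a nonzero factor, an affine function
    of x0 that does not vanish identically, so a generic x0 avoids the problem. The double points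
    solve two equations in (x, y), one per component. Both contain the diagonal, which would make
    the resultant vanish; the equation of P/Q is therefore divided by y - x. At x = x0 only the root
    y = w remains, and r separates x0 from w. In the null class r would be constant and give no
    second equation. The exponential replaces it: its derivative never vanishes, so immersivity is
    automatic, and its periods index the possible differences y - x. *)

Lemma normc_ge_Re (z : R[i]) : `|complex.Re z|%:C <= `|z|.
Proof.
rewrite normc_def lecR -sqrtr_sqr ler_sqrt ?lerDl ?sqr_ge0//.
by rewrite addr_ge0 ?sqr_ge0.
Qed.

Lemma normc_ge_Im (z : R[i]) : `|complex.Im z|%:C <= `|z|.
Proof.
rewrite normc_def lecR -sqrtr_sqr ler_sqrt ?lerDr ?sqr_ge0//.
by rewrite addr_ge0 ?sqr_ge0.
Qed.

Lemma norm_real_complex (x : R) : `|x%:C| = `|x|%:C.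
Proof. by rewrite normc_def /= expr0n addr0 sqrtr_sqr. Qed.

Lemma gt0_complexP (e : R[i]) : 0 < e -> exists2 d : R, 0 < d & e = d%:C.
Proof.
rewrite ltcE /= => /andP[/eqP ei e0]; exists (complex.Re e) => //.
by case: e ei {e0} => a b /= ->.
Qed.

Lemma continuous_Re : continuous (@complex.Re R : C -> R).
Proof.
move=> z; apply/(@cvgrPdist_lt _ _ C (nbhs (z : C)) (nbhs_filter (z : C))) => e
  e0.
have e0' : 0 < e%:C by rewrite ltcR.
have := @nbhsx_ballx _ C z _ e0';
  apply: (@filterS _ (nbhs (z : C)) _) => w /= zw; rewrite -ltcR.
have -> : complex.Re z - complex.Re w = complex.Re (z - w).
  by case: z {zw} => ? ?; case: w.
exact: le_lt_trans (normc_ge_Re _) zw.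
Qed.

Lemma continuous_Im : continuous (@complex.Im R : C -> R).
Proof.
move=> z; apply/(@cvgrPdist_lt _ _ C (nbhs (z : C)) (nbhs_filter (z : C))) => e
  e0.
have e0' : 0 < e%:C by rewrite ltcR.
have := @nbhsx_ballx _ C z _ e0';
  apply: (@filterS _ (nbhs (z : C)) _) => w /= zw; rewrite -ltcR.
have -> : complex.Im z - complex.Im w = complex.Im (z - w).
  by case: z {zw} => ? ?; case: w.
exact: le_lt_trans (normc_ge_Im _) zw.
Qed.

Lemma continuous_real_complex : continuous (fun x : R => x%:C : C).
Proof.
move=> x; apply/(@cvgrPdist_lt _ C) => _ /gt0_complexP[e e0 ->].
near=> y; rewrite -rmorphB /= norm_real_complex ltcR.
by near: y; apply: cvgr_dist_lt.
Unshelve. all: by end_near. Qed.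

Lemma continuous_Complex (T : topologicalType) (f g : T -> R) (t : T) :
  {for t, continuous f} -> {for t, continuous g} ->
  {for t, continuous (fun x => f x +i* g x : C)}.
Proof.
move=> cf cg.
have -> : (fun x => f x +i* g x : C) =
   (fun x => (f x)%:C + 'i%C * (g x)%:C : C).
  by apply/funext => x; rewrite [LHS]complexE.
apply: (@cvgD _ C).
  exact: (continuous_comp cf (@continuous_real_complex _)).
apply: (@cvgM C); first exact: cvg_cst.
exact: (continuous_comp cg (@continuous_real_complex _)).
Qed.

Section Pointwise.
Variables (T : topologicalType) (x : T).
Implicit Types f g : T -> C.

Lemma continuous_at_cst (c : C) : {for x, continuous (fun=> c : C)}.
Proof. exact: cvg_cst. Qed.

Lemma continuous_atD f g : {for x, continuous f} -> {for x, continuous g} ->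
  {for x, continuous (fun y => f y + g y : C)}.
Proof. by move=> cf cg; exact: (@cvgD _ C _ _ _ f g _ _ cf cg). Qed.

Lemma continuous_atN f : {for x, continuous f} -> {for x, continuous (fun y =>
  - f y : C)}.
Proof. by move=> cf; exact: (@cvgN _ C _ _ _ f _ cf). Qed.

Lemma continuous_atM f g : {for x, continuous f} -> {for x, continuous g} ->
  {for x, continuous (fun y => f y * g y : C)}.
Proof. by move=> cf cg; exact: (@cvgM C _ _ _ f g _ _ cf cg). Qed.

Lemma continuous_atV f : f x != 0 -> {for x, continuous f} ->
  {for x, continuous (fun y => (f y)^-1 : C)}.
Proof. by move=> f0 cf; exact: (@cvgV C _ _ _ f _ f0 cf). Qed.

Lemma continuous_at_comp (U V : topologicalType) (h : T -> U) (k : U -> V) :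
  {for x, continuous h} -> {for h x, continuous k} ->
  {for x, continuous (fun y => k (h y))}.
Proof. exact: continuous_comp. Qed.

Lemma continuous_at_pair (U V : topologicalType) (h : T -> U) (k : T -> V) :
  {for x, continuous h} -> {for x, continuous k} ->
  {for x, continuous (fun y => (h y, k y))}.
Proof.
move=> ch ck.
exact: (@cvg_pair _ _ _ (nbhs x) (nbhs (h x)) (nbhs (k x)) _ _ _ h k ch ck).
Qed.

Lemma continuous_at_near (U : topologicalType) (f g : T -> U) :
  (\forall y \near x, f y = g y) ->
  {for x, continuous f} -> {for x, continuous g}.
Proof.
move=> fg cf; have fgx : f x = g x := nbhs_singleton fg.
rewrite /prop_for /continuous_at -fgx.
apply: cvg_trans cf; apply: near_eq_cvg.
by apply: filterS fg => z ->.
Qed.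

End Pointwise.

End ComplexTopology.

(** * The complex exponential *)

Section ComplexExponential.
Local Open Scope complex_scope.
Variable R : realType.
Local Notation C := (R[i]^o).

Definition cexp (z : R[i]) : R[i] :=
  (expR (complex.Re z) * cos (complex.Im z)) +i*
  (expR (complex.Re z) * sin (complex.Im z)).

Lemma cexp0 : cexp 0 = 1.
Proof. by rewrite /cexp /= expR0 cos0 sin0 mulr1 mulr0. Qed.

Lemma cexpD z w : cexp (z + w) = cexp z * cexp w.
Proof.
case: z => a b; case: w => c d; rewrite /cexp /= expRD cosD sinD.
apply/eqP; rewrite eq_complex /=; apply/andP; split; apply/eqP; ring.
Qed.

Lemma cexp_neq0 z : cexp z != 0.
Proof.
have := oner_neq0 R[i];
  rewrite -cexp0 -[X in cexp X](subrr z) cexpD mulf_eq0 negb_or.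
by case/andP.
Qed.

Lemma cexpN z : cexp (- z) = (cexp z)^-1.
Proof.
apply: (mulfI (cexp_neq0 z)); rewrite -cexpD subrr cexp0 mulfV//.
exact: cexp_neq0.
Qed.

Lemma cexp_sum I (r : seq I) (P : pred I) (F : I -> R[i]) :
  cexp (\sum_(i <- r | P i) F i) = \prod_(i <- r | P i) cexp (F i).
Proof. by elim/big_rec2: _ => [|i x y _ <-]; rewrite ?cexp0 ?cexpD. Qed.

Lemma cexpMn z n : cexp (z *+ n) = cexp z ^+ n.
Proof. by elim: n => [|n ih]; rewrite ?mulr0n ?cexp0// mulrS cexpD ih exprS. Qed.

Lemma cexpMz z (m : int) : cexp (z *~ m) = cexp z ^ m.
Proof.
case: m => n; first by rewrite -pmulrn cexpMn.
by rewrite NegzE mulrNz cexpN -exprnN -pmulrn cexpMn.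
Qed.

Lemma cexp_i (t : R) : cexp (0 +i* t) = cos t +i* sin t.
Proof. by rewrite /cexp /= expR0 !mul1r. Qed.

Lemma norm_cexp_i (t : R) : `|cexp (0 +i* t)| = 1.
Proof. by rewrite cexp_i normc_def /= cos2Dsin2 sqrtr1. Qed.

Lemma cexp_2pi : cexp (0 +i* (pi *+ 2)) = 1.
Proof. by rewrite cexp_i cos2pi sin2pi. Qed.

Lemma imagMz (t : R) (m : int) : (0 +i* t) *~ m = 0 +i* (t *~ m) :> R[i].
Proof.
have iE u : 0 +i* u = 'i%C * u%:C :> R[i] by simpc.
by rewrite (iE t) (iE (t *~ m)) -mulrzAr raddfMz.
Qed.

(** Subtracting the floor multiple of the period leaves an imaginary part b in [0, 2 pi[ with cos b
    = 1. Since 1 - cos b = 2 sin(b/2)^2 and sin is positive on ]0, pi[, b is 0. *)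
Lemma cexp_eq1 z : cexp z = 1 -> exists m : int, z = (0 +i* (pi *+ 2)) *~ m.
Proof.
move=> z1; have pi0 : 0 < pi *+ 2 :> R by rewrite mulrn_wgt0// pi_gt0.
pose m := Num.floor (complex.Im z / (pi *+ 2)).
exists m; apply/eqP; rewrite -subr_eq0; set w := _ - _.
have w1 : cexp w = 1 by rewrite cexpD cexpN cexpMz cexp_2pi exp1rz invr1 mulr1.
have ImB (u v : R[i]) : complex.Im (u - v) = complex.Im u - complex.Im v.
  by case: u; case: v.
have iw : complex.Im w = complex.Im z - (pi *+ 2) *~ m.
  by rewrite /w imagMz ImB.
have w0 : 0 <= complex.Im w.
  rewrite iw subr_ge0 -mulrzl -ler_pdivlMr//; exact: floor_le_tmp.
have w2 : complex.Im w < pi *+ 2.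
  have := floorD1_gt (complex.Im z / (pi *+ 2)).
  rewrite ltr_pdivrMr// intrD -/m mulrDl mul1r mulrzl => lt_m.
  by rewrite iw ltrBlDr addrC.
move: w w1 w0 w2 {iw} => [a b] /=; rewrite /cexp /= => -[ac as0] b0 b2.
have /eqP sb : sin b = 0.
  by apply: (mulfI (lt0r_neq0 (expR_gt0 a))); rewrite as0 mulr0.
have cb0 : 0 < cos b.
  by rewrite -(pmulr_rgt0 _ (expR_gt0 a)) ac.
have cb : cos b = 1.
  by have := cos2Dsin2 b; rewrite (eqP sb); nra.
have a0 : a = 0 by apply: expR_inj; rewrite expR0 -ac cb mulr1.
have : b = 0.
  have [//|b_neq0] := eqVneq b 0.
  have b_gt0 : 0 < b by rewrite lt_neqAle eq_sym b_neq0.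
  have : 0 < sin (b / 2).
    by apply: sin_gt0_pi; rewrite divr_gt0//= ltr_pdivrMr// mulr_natr.
  have := cosD (b / 2) (b / 2); rewrite -splitr cb.
  have := cos2Dsin2 (b / 2); nra.
by move=> ->; rewrite a0.
Qed.

(** The bound on the argument matters later: lifts of loops are controlled only on a bounded
    interval. *)
Lemma cexp_surj w : w != 0 ->
  exists2 z, cexp z = w & `|complex.Im z| <= pi.
Proof.
case: w => x y xy0; pose n := Num.sqrt (x ^+ 2 + y ^+ 2).
have s0 : 0 < x ^+ 2 + y ^+ 2.
  rewrite lt_neqAle addr_ge0 ?sqr_ge0// andbT eq_sym paddr_eq0 ?sqr_ge0//.
  by rewrite !sqrf_eq0; move: xy0; rewrite eq_complex.
have n0 : 0 < n by rewrite sqrtr_gt0.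
have n2 : n ^+ 2 = x ^+ 2 + y ^+ 2 by rewrite sqr_sqrtr// ltW.
have xn : -1 <= x / n <= 1.
  rewrite ler_pdivlMr// ler_pdivrMr// mul1r mulN1r -ler_norml.
  by rewrite -sqrtr_sqr ler_sqrt ?lerDl ?sqr_ge0// ltW.
pose t := acos (x / n).
have ct : n * cos t = x by rewrite acosK ?in_itv//= mulrC divfK ?gt_eqF.
have st : n * sin t = `|y|.
  rewrite sin_acos//; have -> : 1 - (x / n) ^+ 2 = (y / n) ^+ 2.
    rewrite !expr_div_n n2; field; exact: lt0r_neq0.
  by rewrite sqrtr_sqr normrM normfV (gtr0_norm n0) mulrC divfK ?gt_eqF.
have tpi : `|t| <= pi by rewrite ger0_norm ?acos_ge0 ?acos_lepi.
exists (ln n +i* (if 0 <= y then t else - t)); last first.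
  by rewrite /=; case: ifP; rewrite ?normrN.
rewrite /cexp /= lnK ?posrE//.
have [y0|y0] := leP 0 y; first by rewrite ct st ger0_norm.
by rewrite cosN sinN mulrN ct st ltr0_norm// opprK.
Qed.

(** The principal logarithm, meant for the right half-plane, where [atan] of the slope is the
    argument and is continuous. Ratios of nearby nonzero values fall there. *)
Definition clog (w : R[i]) : R[i] :=
  ln (Num.sqrt (complex.Re w ^+ 2 + complex.Im w ^+ 2)) +i*
  atan (complex.Im w / complex.Re w).

Lemma clogK w : 0 < complex.Re w -> cexp (clog w) = w.
Proof.
case: w => x y /= x0; rewrite /clog /cexp /=.
have s0 : 0 < x ^+ 2 + y ^+ 2 by rewrite ltr_pwDl ?exprn_gt0 ?sqr_ge0.
rewrite lnK ?posrE ?sqrtr_gt0//.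
have ct : Num.sqrt (x ^+ 2 + y ^+ 2) * cos (atan (y / x)) = x.
  rewrite cos_atan; have -> : x ^+ 2 + y ^+ 2 = x ^+ 2 * (1 + (y / x) ^+ 2).
    by field; exact: lt0r_neq0.
  rewrite sqrtrM ?sqr_ge0// sqrtr_sqr gtr0_norm// mulfK//.
  by rewrite gt_eqF// sqrtr_gt0 ltr_pwDl// sqr_ge0.
have ca : cos (atan (y / x)) != 0.
  by apply/eqP => c0; move: ct x0; rewrite c0 mulr0 => <-; rewrite ltxx.
have st : sin (atan (y / x)) = y / x * cos (atan (y / x)).
  by rewrite -(divfK ca (sin (atan (y / x)))) -/(tan _) atanK.
by rewrite ct st mulrCA ct divfK ?gt_eqF.
Qed.

Lemma continuous_cexp : continuous (cexp : C -> C).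
Proof.
move=> z; apply: (@continuous_Complex R C
    (fun z => expR (complex.Re z) * cos (complex.Im z))
    (fun z => expR (complex.Re z) * sin (complex.Im z)) z); apply: continuousM.
- apply: continuous_comp; [exact: continuous_Re|exact: continuous_expR].
- apply: continuous_comp; [exact: continuous_Im|exact: continuous_cos].
- apply: continuous_comp; [exact: continuous_Re|exact: continuous_expR].
- apply: continuous_comp; [exact: continuous_Im|exact: continuous_sin].
Qed.

Lemma continuous_clog (w : C) : 0 < complex.Re w ->
  {for w, continuous (clog : C -> C)}.
Proof.
move=> w0; have cR := @continuous_Re R w; have cI := @continuous_Im R w.
have s0 : 0 < complex.Re w ^+ 2 + complex.Im w ^+ 2.
  by rewrite ltr_pwDl ?exprn_gt0 ?sqr_ge0.
apply: (@continuous_Complex R C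
    (fun w => ln (Num.sqrt (complex.Re w ^+ 2 + complex.Im w ^+ 2)))
    (fun w => atan (complex.Im w / complex.Re w)) w).
  apply: continuous_comp; last by apply: continuous_ln; rewrite sqrtr_gt0.
  apply: continuous_comp; last exact: sqrt_continuous.
  by apply: continuousD; apply: continuousM.
apply: continuous_comp; last exact: continuous_atan.
by apply: continuousM => //; apply: continuousV => //; rewrite gt_eqF.
Qed.

End ComplexExponential.

Arguments cexp {R}.
Arguments clog {R}.

(** * Complex differentiability of the exponential *)

Section ComplexExponentialDerivative.
Local Open Scope complex_scope.
Variable R : realType.
Local Notation C := (R[i]^o).

Lemma is_derive_approx (f : R -> R) (d e : R) :
  is_derive (0 : R) (1 : R) f d -> 0 < e ->
  exists2 r, 0 < r & forall h, `|h| < r -> `|f h - f 0 - d * h| <= e * `|h|.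
Proof.
move=> [df fd] e0.
have := df; rewrite /derivable => /cvgrPdist_le/(_ _ e0).
have -> : lim (h^-1 *: ((f \o shift 0) (h *: 1) - f 0) @[h --> 0^']) = d.
  exact: fd.
rewrite near_withinE => /nbhs_ballP[r /= r0 rP]; exists r => // h hr.
have [->|h0] := eqVneq h 0; first by rewrite subrr mulr0 subr0 normr0 mulr0.
have := rP h; rewrite /ball /= sub0r normrN addr0 => /(_ hr h0).
rewrite [h%:A]mulr1 => le_e.
have -> : f h - f 0 - d * h = - ((d - h^-1 *: (f h - f 0)) * h).
  by rewrite /GRing.scale /=; field.
by rewrite normrN normrM ler_pM2r ?normr_gt0.
Qed.

Lemma le_normc_ReIm (w : R[i]) :
  `|w| <= (`|complex.Re w| + `|complex.Im w|)%:C.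
Proof.
rewrite {1}[w]complexE (le_trans (ler_normD _ _))// normrM.
have -> : `|'i%C| = 1 :> R[i] by rewrite normc_def /= expr0n add0r expr1n sqrtr1.
by rewrite mul1r !norm_real_complex -rmorphD.
Qed.

Lemma cexp_approx (e : R) : 0 < e ->
  exists2 r : R, 0 < r & forall h : R[i], `|h| < r%:C ->
    `|cexp h - 1 - h| <= e%:C * `|h|.
Proof.
(* The 6 counts the errors of size k |h|: three in the real part ([P1]), three in the imaginary part
   ([P2]). With k <= 1 and |a| < k / 2, |e^a - 1| is at most 2 |a| <= k, and e^a at most 2. *)
move=> e0; pose k := Num.min (e / 6) 1.
have k0 : 0 < k by rewrite lt_min divr_gt0//=.
have ke : 6 * k <= e.
  by rewrite mulrC -ler_pdivlMr// ge_min lexx.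
have k1 : k <= 1 by rewrite ge_min lexx orbT.
have [r1 r10 E] := is_derive_approx (is_derive_expR (0 : R)) k0.
have [r2 r20 S] := is_derive_approx (is_derive_sin (0 : R)) k0.
have [r3 r30 D] := is_derive_approx (is_derive_cos (0 : R)) k0.
pose r := Num.min (Num.min r1 (k / 2)) (Num.min r2 r3).
exists r => [|h hr]; first by rewrite !lt_min r10 r20 r30 divr_gt0.
apply: (le_trans (le_normc_ReIm _)).
have := le_lt_trans (normc_ge_Re h) hr; have := le_lt_trans (normc_ge_Im h) hr.
have := normc_ge_Re h; have := normc_ge_Im h.
rewrite (normc_def h); set n := Num.sqrt _; rewrite -rmorphM !lecR !ltcR.
move=> hi hr'; rewrite !lt_min => /andP[/andP[b1 bk] /andP[b2 b3]].
move=> /andP[/andP[a1 ak] _].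
move: (E _ a1) (S _ b2) (D _ b3).
rewrite expR0 sin0 cos0 !subr0 oppr0 !mul0r !mul1r !subr0 {E S D}.
have -> : complex.Re (cexp h - 1 - h) =
  expR (complex.Re h) * cos (complex.Im h) - 1 - complex.Re h by case: (h).
have -> : complex.Im (cexp h - 1 - h) =
  expR (complex.Re h) * sin (complex.Im h) - 0 - complex.Im h by case: (h).
move: hi hr' bk ak; set a := complex.Re h; set b := complex.Im h.
move=> bn an bk ak.
set ea := expR a; set sb := sin b; set cb := cos b => Ea Sb Cb.
have ea2 : `|ea - 1| <= 2 * `|a|.
  have -> : ea - 1 = (ea - 1 - a) + a by ring.
  rewrite (le_trans (ler_normD _ _))// mulr2n mulrDl mul1r lerD2r.
  by rewrite (le_trans Ea)// ler_piMl.
have ea3 : `|ea| <= 2.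
  have -> : ea = (ea - 1) + 1 by ring.
  rewrite (le_trans (ler_normD _ _))// normr1; lra.
have P1 : `|ea * cb - 1 - a| <= k * `|a| + 2 * (k * `|b|).
  have -> : ea * cb - 1 - a = (ea - 1 - a) + ea * (cb - 1) by ring.
  rewrite (le_trans (ler_normD _ _))// lerD// normrM.
  by apply: ler_pM.
have P2 : `|ea * sb - 0 - b| <= 2 * (k * `|b|) + k * `|b|.
  have -> : ea * sb - 0 - b = ea * (sb - b) + (ea - 1) * b by ring.
  apply: (le_trans (ler_normD _ _)); apply: lerD; rewrite normrM.
    exact: ler_pM.
  by apply: ler_wpM2r => //; rewrite (le_trans ea2)//; lra.
have kn : 0 <= k * n by rewrite mulr_ge0 ?sqrtr_ge0// ltW.
have ka : k * `|a| <= k * n by rewrite ler_pM2l.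
have kb : k * `|b| <= k * n by rewrite ler_pM2l.
have kne : 6 * (k * n) <= e * n.
  by rewrite mulrA ler_wpM2r ?sqrtr_ge0.
lra.
Qed.

Lemma is_derive_cexp (z : C) : is_derive z 1 (cexp : C -> C) (cexp z).
Proof.
suff cv : (h^-1 *: ((cexp \o shift z) (h *: (1 : C)) - cexp z : C)) @[h --> (0
  : C)^']
    --> (cexp z : C).
  apply: DeriveDef; first by apply/cvg_ex; exists (cexp z).
  exact: (cvg_lim (@norm_hausdorff _ C) cv).
have : ((cexp h - 1) / h : C) @[h --> (0 : C)^'] --> (1 : C).
  apply/(@cvgrPdist_le _ C) => _ /gt0_complexP[e e0 ->].
  have [r r0 rP] := cexp_approx e0.
  rewrite near_withinE; apply/nbhs_ballP; exists r%:C; first by rewrite /= ltcR.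
  move=> h; rewrite /ball /= sub0r normrN => hr h0.
  have -> : 1 - (cexp h - 1) / h = - ((cexp h - 1 - h) / h) by field.
  by rewrite normrN normrM normfV ler_pdivrMr ?normr_gt0//; exact: rP.
move=> cv.
have -> : (fun h : C => h^-1 *: ((cexp \o shift z) (h *: (1 : C)) - cexp z : C)) =
    (fun h : C => cexp z * ((cexp h - 1) / h) : C).
  by apply/funext => h /=; rewrite [h%:A]mulr1 cexpD /GRing.scale /=; ring.
rewrite -[X in _ --> X]mulr1; apply: (@cvgM C); [exact: cvg_cst|exact: cv].
Qed.

End ComplexExponentialDerivative.

(** * Winding numbers *)

Section Lifting.
Local Open Scope complex_scope.
Variable R : realType.
Local Notation C := (R[i]^o).

Lemma continuous_sum_nat (T : topologicalType) (F : nat -> T -> C) m (x : T) :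
  (forall j, (j < m)%N -> {for x, continuous (F j)}) ->
  {for x, continuous (fun y => \sum_(0 <= j < m) F j y : C)}.
Proof.
elim: m => [|m ih] cF.
  have -> : (fun y => \sum_(0 <= j < 0) F j y : C) = cst 0.
    by apply/funext => y; rewrite big_nil.
  exact: cvg_cst.
have -> : (fun y => \sum_(0 <= j < m.+1) F j y : C) =
    (fun y => (\sum_(0 <= j < m) F j y) + F m y : C).
  by apply/funext => y; rewrite big_nat_recr.
apply: (@cvgD _ C); last exact: cF.
by apply: ih => j jm; apply: cF; rewrite ltnS ltnW.
Qed.

(** The ratio is 1 on the diagonal, so its real part is positive nearby, and compactness of [-T, T]
    makes the width of that neighbourhood uniform. *)
Lemma ratio_Re_gt0 (gam : R -> C) (T : R) :
  continuous gam -> (forall t, gam t != 0) ->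
  exists2 d : R, 0 < d & forall s t, `|t| <= T -> `|s - t| <= d ->
    0 < complex.Re (gam s / gam t).
Proof.
move=> cg g0.
(* The radius is [|d|], so that d can range over a full neighbourhood of 0, as the near-covering
   form of compactness asks. *)
have : \forall d \near (0 : R), `[- T, T]%classic `<=`
    [set t | forall s, `|s - t| <= `|d| -> 0 < complex.Re (gam s / gam t)].
  have /compact_near_coveringP cov := @segment_compact R (- T) T.
  apply: (cov R (nbhs (0 : R)) (fun d t =>
    forall s, `|s - t| <= `|d| -> 0 < complex.Re (gam s / gam t))).
  move=> t0 _.
  have cq : {for (t0, t0), continuous (fun p : R * R =>
      complex.Re (gam p.1 / gam p.2))}.
    apply: (@continuous_comp _ _ _ (fun p : R * R => gam p.1 / gam p.2 : C)
      (@complex.Re R : C -> R)); last exact: continuous_Re.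
    apply: (@cvgM C).
      by apply: (@continuous_comp _ _ _ fst gam); [exact: cvg_fst|exact: cg].
    apply: (@cvgV C); first exact: g0.
    by apply: (@continuous_comp _ _ _ snd gam); [exact: cvg_snd|exact: cg].
  have : \forall p \near (t0, t0), 0 < complex.Re (gam p.1 / gam p.2).
    apply: (cq [set x | 0 < x]).
    by rewrite /= divff//=; apply: lt_nbhsr.
  move=> /nbhs_ballP[r /= r0 rP].
  exists (ball t0 (r / 2), ball (0 : R) (r / 2)).
    by split; apply: nbhsx_ballx; rewrite divr_gt0.
  move=> [t d] /= [tb db] s sd; apply: (rP (s, t)); split => /=.
    rewrite /ball /= in tb db *; rewrite sub0r normrN in db.
    have -> : t0 - s = (t0 - t) + (t - s) by ring.
    rewrite [r]splitr (le_lt_trans (ler_normD _ _))// ltrD//.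
    by rewrite distrC (le_lt_trans sd).
  rewrite /ball /= in tb *; apply: (lt_le_trans tb).
  by rewrite ler_pdivrMr// ler_peMr ?ler1n// ltW.
move=> /nbhs_ballP[r /= r0 rP]; exists (r / 2); first by rewrite divr_gt0.
move=> s t tT sd; apply: (rP (r / 2)).
- rewrite /ball /= sub0r normrN gtr0_norm ?divr_gt0// ltr_pdivrMr//.
  by rewrite ltr_pMr// ltr1n.
- by rewrite /= in_itv /= -ler_norml.
- by rewrite [`|r / 2|]gtr0_norm// divr_gt0.
Qed.

(** The segment from 0 to t is cut into m equal steps, so short that consecutive values of [gam]
    have a ratio in the domain of [clog]. The logarithms of these ratios are summed, and their
    exponentials telescope. *)
Lemma log_lift (gam : R -> C) (T : R) : 0 < T ->
  continuous gam -> (forall t, gam t != 0) ->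
  exists2 S : R -> C, continuous S &
    forall t, `|t| <= T -> gam t = gam 0 * cexp (S t).
Proof.
move=> T0 cg g0; have [d d0 dP] := @ratio_Re_gt0 gam T cg g0.
pose m := (Num.truncn (T / d)).+1.
have m0 : 0 < m%:R :> R by rewrite ltr0n.
have Tm : T / m%:R <= d.
  by rewrite ler_pdivrMr// mulrC -ler_pdivrMr// ltW// truncnS_gt.
(* Clamping keeps every subdivision point in [-T, T], where the step [d] is valid, and makes the
   lift continuous on the whole line. *)
pose clip (t : R) := Num.min (Num.max t (- T)) T.
have clipT t : `|clip t| <= T.
  rewrite ler_norml le_min ge_min lexx orbT le_max lexx orbT /= andbT.
  lra.
have clip_id t : `|t| <= T -> clip t = t.
  by rewrite ler_norml => /andP[t1 t2]; rewrite /clip max_l// min_l.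
pose q (j : nat) (t : R) : R := j%:R / m%:R * clip t.
have cq j : continuous (q j).
  move=> t; rewrite /q; apply: cvgM; first exact: cvg_cst.
  apply: (@continuous_min R R (fun t => Num.max t (- T)) (cst T)).
    by apply: (@continuous_max R R id (cst (- T)));
      [exact: cvg_id|exact: cvg_cst].
  exact: cvg_cst.
have Re_q j t : (j < m)%N -> 0 < complex.Re (gam (q j.+1 t) / gam (q j t)).
  move=> jm; apply: dP.
    rewrite /q normrM ger0_norm ?divr_ge0// -[T]mul1r ler_pM ?divr_ge0//.
    by rewrite ler_pdivrMr// mul1r ler_nat ltnW.
  have -> : q j.+1 t - q j t = clip t / m%:R.
    by rewrite /q -natr1; field; rewrite gt_eqF.
  rewrite normrM normfV (gtr0_norm m0) (le_trans _ Tm)//.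
  by rewrite ler_pM2r ?invr_gt0.
exists (fun t => \sum_(0 <= j < m) clog (gam (q j.+1 t) / gam (q j t))).
  move=> t; apply: continuous_sum_nat => j jm.
  apply: (@continuous_comp _ _ _ (fun t => gam (q j.+1 t) / gam (q j t) : C)
    (clog : C -> C)); last by apply: continuous_clog; exact: Re_q.
  apply: (@cvgM C).
    by apply: (@continuous_comp _ _ _ (q j.+1) gam); [exact: cq|exact: cg].
  apply: (@cvgV C); first exact: g0.
  by apply: (@continuous_comp _ _ _ (q j) gam); [exact: cq|exact: cg].
move=> t tT; rewrite cexp_sum.
rewrite (@telescope_prodf_eq _ 0%N m (fun j => gam (q j t))) //.
- rewrite /q mul0r mul0r divff ?gt_eqF// mul1r clip_id//.
  by rewrite mulrCA divff// mulr1.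
- by move=> j jm; rewrite clogK//; exact: Re_q.
Qed.

Lemma int_valued_constant (phi : R -> R) (a b : R) :
  continuous phi ->
  (forall t, a <= t <= b -> exists m : int, phi t = m%:~R) ->
  forall s t, a <= s <= b -> a <= t <= b -> phi s = phi t.
Proof.
move=> cphi iphi; suff H : forall s t, s <= t -> a <= s <= b -> a <= t <= b ->
  phi s = phi t.
  move=> s t sab tab; have [st|ts] := leP s t; first exact: H.
  by apply/esym/H => //; exact: ltW.
move=> s t st /andP[as_ sb] /andP[at_ tb].
have [m1 E1] := iphi s (introT andP (conj as_ sb)).
have [m2 E2] := iphi t (introT andP (conj at_ tb)).
have [m12|] := eqVneq m1 m2; first by rewrite E1 E2 m12.
(* A half-integer between the two integer values: the intermediate value theorem would make [phi]
   reach it. *)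
pose v : R := (Num.min m1 m2)%:~R + 1 / 2.
move=> m12; exfalso.
have [||c cst cv] := @IVT R phi s t v st.
- exact: continuous_subspaceT.
- rewrite /v E1 E2; case: (ltgtP m1 m2) m12 => // lt_m _.
    have : m1%:~R + 1 <= m2%:~R :> R by rewrite -[1]/(1%:~R) -intrD ler_int lezD1.
    move=> h; rewrite ge_min le_max; apply/andP; split; apply/orP; [left|right];
      lra.
  have : m2%:~R + 1 <= m1%:~R :> R by rewrite -[1]/(1%:~R) -intrD ler_int lezD1.
  move=> h; rewrite ge_min le_max; apply/andP; split; apply/orP; [right|left];
    lra.
have [m3 E3] : exists m : int, phi c = m%:~R.
  apply: iphi; move: cst; rewrite in_itv /= => /andP[sc ct].
  by rewrite (le_trans as_ sc) (le_trans ct tb).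
move: cv; rewrite E3 /v => cv.
have h1 : (Num.min m1 m2)%:~R < m3%:~R :> R by lra.
have h2 : m3%:~R < (Num.min m1 m2)%:~R + 1 :> R by lra.
rewrite -[1]/(1%:~R) -intrD !ltr_int in h1 h2; lia.
Qed.

End Lifting.

(** * The degree of a loop of nonzero complex numbers *)

Section Winding.
Local Open Scope complex_scope.
Variable R : realType.
Local Notation C := (R[i]^o).
Local Notation tau := (pi *+ 2 : R).

Lemma continuous_atMz (T : topologicalType) (f : T -> C) (k : int) (x : T) :
  {for x, continuous f} -> {for x, continuous (fun y => f y *~ k : C)}.
Proof.
move=> cf; have -> : (fun y => f y *~ k : C) = (fun y => f y * k%:~R : C).
  by apply/funext => y; rewrite mulrzr.
by apply: continuous_atM; [exact: cf|exact: continuous_at_cst].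
Qed.

(** A logarithm S of the loop increases over one turn by 2 i pi k, where k is the winding number.
    Subtracting k w from S (Im w) makes it invariant under w -> w + 2 i pi, so that it descends
    along [cexp] to a function of z = [cexp w]. *)
Lemma winding_number (gam : R -> C) :
  continuous gam -> (forall t, gam t != 0) -> periodic gam tau ->
  exists (k : int) (g : C -> C),
    (forall z, z != 0 -> {for z, continuous g}) /\
    (forall z, z != 0 -> exists2 w, cexp w = z &
       gam (complex.Im w) = z ^ k * cexp (g z)).
Proof.
move=> cg g0 gP; have pi0 := @pi_gt0 R.
have tau0 : 0 < tau by rewrite mulrn_wgt0.
have [S cS SE] := log_lift tau0 cg g0.
(* S is a logarithm of the loop on [-tau, tau] only, hence the increment over a turn is studied for
   t in [-tau, 0]: there it is a multiple of 2 i pi, and by continuity always the same one. *)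
pose D t := S (t + tau) - S t.
have D_int t : - tau <= t <= 0 -> exists m : int, D t = (0 +i* tau) *~ m.
  move=> /andP[t1 t2]; apply: cexp_eq1; rewrite cexpD cexpN.
  apply: (mulfI (g0 0)); rewrite mulrA mulr1 -SE; last by rewrite ler_norml; lra.
  rewrite gP (SE t) ?mulfK ?cexp_neq0//; rewrite ler_norml; lra.
have Im_D t : - tau <= t <= 0 -> exists m : int, complex.Im (D t) / tau = m%:~R.
  move=> /D_int[m ->]; exists m; rewrite imagMz /= -mulrzl mulfK//.
  by rewrite gt_eqF.
have D_cst t : - tau <= t <= 0 -> D t = D 0.
  move=> tt; have [m1 E1] := D_int t tt.
  have t00 : - tau <= (0 : R) <= 0 by rewrite lexx andbT; lra.
  have [m2 E2] := D_int 0 t00.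
  have : complex.Im (D t) / tau = complex.Im (D 0) / tau.
    apply: (@int_valued_constant R (fun t => complex.Im (D t) / tau) (- tau) 0)
      => //.
    move=> u; apply: cvgM; last exact: cvg_cst.
    apply: (@continuous_comp _ _ _ D (@complex.Im R : C -> R));
      last exact: continuous_Im.
    apply: (@cvgB _ C); last exact: cS.
    apply: (@continuous_comp _ _ _ (fun u => u + tau) S); last exact: cS.
    by apply: cvgD; [exact: cvg_id|exact: cvg_cst].
  move=> /(mulIf (invr_neq0 (lt0r_neq0 tau0))).
  by rewrite E1 E2 !imagMz /= => ->.
have [k Dk] : exists k : int, D 0 = (0 +i* tau) *~ k.
  by apply: D_int; rewrite lexx andbT; lra.
have S_shift n t : - tau <= t -> t + tau *+ n <= tau ->
    S (t + tau *+ n) = S t + (0 +i* tau) *~ k *+ n.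
  elim: n t => [|n ih] t t1 t2; first by rewrite !mulr0n !addr0.
  have n0 : 0 <= tau *+ n by rewrite mulrn_wge0// ltW.
  have tt : - tau <= t <= 0 by rewrite t1; move: t2; rewrite mulrS; lra.
  rewrite mulrS addrA ih; first last.
  - by move: t2; rewrite mulrS addrA.
  - lra.
  have -> : S (t + tau) = S t + (0 +i* tau) *~ k.
    by rewrite -Dk -(D_cst t tt) /D [RHS]addrC subrK.
  by rewrite -addrA -mulrS.
pose F (w : C) : C := S (complex.Im w) - w *~ k.
have F_inj w w' : `|complex.Im w| <= tau -> `|complex.Im w'| <= tau ->
    cexp w = cexp w' -> F w = F w'.
  have H (v : C) n : `|complex.Im v| <= tau ->
      `|complex.Im (v + (0 +i* tau) *~ Posz n)| <= tau ->
      F v = F (v + (0 +i* tau) *~ Posz n).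
    have -> : complex.Im (v + (0 +i* tau) *~ Posz n) = complex.Im v + tau *+ n.
      by rewrite imagMz; case: (v).
    rewrite !ler_norml => /andP[v1 v2] /andP[v3 v4].
    rewrite /F; have -> : complex.Im (v + (0 +i* tau) *~ Posz n) = complex.Im v
      + tau *+ n.
      by rewrite imagMz; case: (v).
    rewrite S_shift//; move: (0 +i* tau) => x.
    have -> : x *~ k *+ n = x *~ Posz n *~ k.
      by rewrite [LHS]pmulrn -!mulrzA mulrC.
    by rewrite mulrzDl opprD addrACA subrr addr0.
  move=> wt wt' e.
  have [m mE] : exists m : int, w' - w = (0 +i* tau) *~ m.
    by apply: cexp_eq1; rewrite cexpD cexpN e mulfV// cexp_neq0.
  case: m mE => n mE.
    have wE : w' = w + (0 +i* tau) *~ Posz n by rewrite -mE addrC subrK.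
    by rewrite wE; apply: H => //; rewrite -wE.
  have wE : w = w' + (0 +i* tau) *~ Posz n.+1.
    by rewrite -[_ *~ _]opprK -mulrNz -NegzE -mE opprB addrC subrK.
  by rewrite wE; apply/esym; apply: H => //; rewrite -wE.
have [c0 c0E _] := cexp_surj (g0 0).
have /choice[W WP] : forall z : C, exists w : C, z != 0 ->
    cexp w = z /\ `|complex.Im w| <= pi.
  move=> z; have [->|z0] := eqVneq z 0; first by exists 0.
  by have [w wE wp] := cexp_surj z0; exists w.
exists k, (fun z => c0 + F (W z)); split => [z0 z00|z z0]; last first.
  have [wE wp] := WP z z0; exists (W z) => //.
  rewrite cexpD c0E /F cexpD cexpN cexpMz wE SE; last first.
    by rewrite (le_trans wp)//; lra.
  by rewrite mulrCA [_ * (z ^ k)^-1]mulrC mulVKf// expfz_neq0.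
have [w0E w0p] := WP z0 z00.
(* The chosen logarithm W need not be continuous; near z0 it is traded for the branch W z0 + clog (z
   / z0), which differs by periods that F ignores. The imaginary part of this branch is at most pi +
   pi in absolute value, which explains lifting up to T = tau. *)
pose L (z : C) : C := c0 + F (W z0 + clog (z / z0)).
have cdiv : {for z0, continuous (fun z : C => z / z0 : C)}.
  by apply: continuous_atM; [exact: cvg_id|exact: continuous_at_cst].
have ccl : {for z0, continuous (fun z : C => clog (z / z0) : C)}.
  apply: (continuous_at_comp cdiv); apply: continuous_clog; rewrite divff//=.
have cw : {for z0, continuous (fun z : C => W z0 + clog (z / z0) : C)}.
  by apply: continuous_atD; [exact: continuous_at_cst|exact: ccl].
have cL : {for z0, continuous L}.
  apply: continuous_atD; first exact: continuous_at_cst.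
  apply: continuous_atD; last by apply: continuous_atN; exact: continuous_atMz.
  apply: (@continuous_at_comp _ _ _ _ (fun z : C => complex.Im (W z0 + clog (z
    / z0))) S).
    apply: (continuous_at_comp cw); exact: continuous_Im.
  exact: cS.
have near_re : \forall z \near z0, 0 < complex.Re (z / z0).
  have cre : {for z0, continuous (fun z : C => complex.Re (z / z0))}.
    apply: (continuous_at_comp cdiv); exact: continuous_Re.
  apply: (cre [set x | 0 < x]); rewrite /= divff//=; exact: lt_nbhsr.
have nearL : \forall z \near z0, L z = c0 + F (W z).
  apply: filterS near_re => z rez; congr (_ + _).
  have z_neq0 : z != 0.
    by apply/eqP => ze; move: rez; rewrite ze mul0r ltxx.
  have [wE wp] := WP z z_neq0.
  apply: F_inj.
  - have -> : complex.Im (W z0 + clog (z / z0)) =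
      complex.Im (W z0) + complex.Im (clog (z / z0)) by case: (W z0).
    rewrite (le_trans (ler_normD _ _))//.
    have := @atan_gtNpi2 R (complex.Im (z / z0) / complex.Re (z / z0)).
    have := @atan_ltpi2 R (complex.Im (z / z0) / complex.Re (z / z0)).
    rewrite /clog /= => a1 a2.
    have : `|atan (complex.Im (z / z0) / complex.Re (z / z0))| <= pi.
      by rewrite ler_norml; lra.
    by move: w0p; lra.
  - by rewrite (le_trans wp)//; lra.
  - by rewrite cexpD w0E clogK// mulrC divfK// wE.
exact: continuous_at_near nearL cL.
Qed.

End Winding.

(** * Homotopies of nonvanishing functions *)

Section Classification.
Local Open Scope complex_scope.
Variable R : realType.
Local Notation C := (R[i]^o).

Lemma continuous_atX (T : topologicalType) (x : T) (f : T -> C) n :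
  {for x, continuous f} -> {for x, continuous (fun y => f y ^+ n : C)}.
Proof.
move=> cf; elim: n => [|n ih].
  have -> : (fun y => f y ^+ 0 : C) = (fun=> 1) by apply/funext => y;
    rewrite expr0.
  exact: continuous_at_cst.
have -> : (fun y => f y ^+ n.+1 : C) = (fun y => f y * f y ^+ n : C).
  by apply/funext => y; rewrite exprS.
exact: continuous_atM.
Qed.

Lemma continuous_atXz (T : topologicalType) (x : T) (f : T -> C) (k : int) :
  f x != 0 -> {for x, continuous f} -> {for x, continuous (fun y => f y ^ k : C)}.
Proof.
move=> f0 cf; case: k => n.
  have -> : (fun y => f y ^ Posz n : C) = (fun y => f y ^+ n : C) by [].
  exact: continuous_atX.
have -> : (fun y => f y ^ Negz n : C) = (fun y => (f y ^+ n.+1)^-1 : C) by [].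
by apply: continuous_atV; [rewrite expf_neq0|exact: continuous_atX].
Qed.

Definition unit_on (X : set C) (h : C -> C) :=
  forall z, X z -> h z != 0 /\ {for z, continuous h}.

(* The time parameter ranges over the whole line, so that continuity can be
   asked at points rather than within a strip. *)
Definition unit_homotopic (X : set C) (h1 h2 : C -> C) :=
  exists H : R * C -> C,
    [/\ forall t z, X z -> H (t, z) != 0 /\ {for (t, z), continuous H},
        forall z, X z -> H (0, z) = h1 z &
        forall z, X z -> H (1, z) = h2 z].

Lemma unit_onM X h1 h2 : unit_on X h1 -> unit_on X h2 ->
  unit_on X (fun z => h1 z * h2 z).
Proof.
move=> u1 u2 z Xz; have [h10 ch1] := u1 z Xz; have [h20 ch2] := u2 z Xz.
by split; [rewrite mulf_neq0|exact: (continuous_atM ch1 ch2)].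
Qed.

Lemma unit_on_cexp X (g : C -> C) : (forall z, X z -> {for z, continuous g}) ->
  unit_on X (fun z => cexp (g z)).
Proof.
move=> cg z Xz; split; first exact: cexp_neq0.
by apply: (continuous_at_comp (cg z Xz)); exact: continuous_cexp.
Qed.

Lemma continuous_at_snd (t : R) (z : C) (h : C -> C) : {for z, continuous h} ->
  {for (t, z), continuous (fun p : R * C => h p.2)}.
Proof.
move=> ch; apply: (@continuous_at_comp _ (t, z) _ _ snd h); first exact: cvg_snd.
exact: ch.
Qed.

Lemma unit_homotopic_eq X h1 h2 h3 : unit_homotopic X h1 h2 ->
  (forall z, X z -> h2 z = h3 z) -> unit_homotopic X h1 h3.
Proof.
by move=> [H [HX H0 H1]] e; exists H; split => // z Xz; rewrite H1// e.
Qed.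

Lemma unit_homotopicW X Y h1 h2 : Y `<=` X -> unit_homotopic X h1 h2 ->
  unit_homotopic Y h1 h2.
Proof.
move=> YX [H [HX H0 H1]]; exists H; split => [t z /YX|z /YX|z /YX].
- exact: HX.
- exact: H0.
- exact: H1.
Qed.

(** The group structure of the nonzero complex numbers replaces concatenation: H K / h2 joins h1 to
    h3, and nothing has to be glued at an intermediate time. *)
Lemma unit_homotopic_trans X h1 h2 h3 : unit_on X h2 ->
  unit_homotopic X h1 h2 -> unit_homotopic X h2 h3 -> unit_homotopic X h1 h3.
Proof.
move=> u2 [H [HX H0 H1]] [K [KX K0 K1]].
exists (fun p => H p * K p * (h2 p.2)^-1); split => [t z Xz|z Xz|z Xz].
- have [Hn cH] := HX t z Xz; have [Kn cK] := KX t z Xz.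
  have [h2n ch2] := u2 z Xz; split; first by rewrite !mulf_neq0// invr_neq0.
  exact: (continuous_atM (continuous_atM cH cK) (continuous_atV h2n
    (continuous_at_snd ch2))).
- by have [h2n _] := u2 z Xz; rewrite H0// K0// mulfK.
- by have [h2n _] := u2 z Xz; rewrite H1// K1//= mulrAC mulfV// mul1r.
Qed.

Lemma unit_homotopicM X h1 h2 u : unit_on X u -> unit_homotopic X h1 h2 ->
  unit_homotopic X (fun z => h1 z * u z) (fun z => h2 z * u z).
Proof.
move=> uu [H [HX H0 H1]]; exists (fun p => H p * u p.2).
split => [t z Xz|z Xz|z Xz]; rewrite ?H0 ?H1//.
have [Hn cH] := HX t z Xz; have [un cu] := uu z Xz.
by split; [rewrite mulf_neq0|exact: (continuous_atM cH (continuous_at_snd cu))].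
Qed.

Lemma unit_homotopic_cexp X h (g : C -> C) : unit_on X h ->
  (forall z, X z -> {for z, continuous g}) ->
  unit_homotopic X h (fun z => h z * cexp (g z)).
Proof.
move=> uh cg; exists (fun p => h p.2 * cexp (p.1%:C * g p.2)).
split => [t z Xz|z Xz|z Xz] /=; last 2 first.
- by rewrite mul0r cexp0 mulr1.
- by rewrite mul1r.
have [hn ch] := uh z Xz; split; first by rewrite mulf_neq0// cexp_neq0.
apply: (continuous_atM (continuous_at_snd ch)).
apply: (@continuous_at_comp _ (t, z) _ _ (fun p : R * C => p.1%:C * g p.2 : C)
  (cexp : C -> C));
  last exact: continuous_cexp.
apply: continuous_atM; last exact: (continuous_at_snd (cg z Xz)).
apply: (@continuous_at_comp _ (t, z) _ _ fst (fun x : R => x%:C : C));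
  first exact: cvg_fst.
exact: continuous_real_complex.
Qed.

Lemma norm_cexp (w : R[i]) : `|cexp w| = (expR (complex.Re w))%:C.
Proof.
case: w => x y; rewrite normc_def /cexp /= !exprMn -mulrDr cos2Dsin2 mulr1.
by rewrite sqrtr_sqr ger0_norm// expR_ge0.
Qed.

Lemma cexp_polar (w : R[i]) :
  cexp w = (expR (complex.Re w))%:C * cexp (0 +i* complex.Im w).
Proof. by case: w => x y; rewrite cexp_i /cexp /=; simpc. Qed.

Lemma continuous_norm (z : C) : {for z, continuous (fun z : C => complex.Re
  `|z|)}.
Proof.
apply: (@continuous_at_comp _ z _ _ (fun z : C => `|z| : C) (@complex.Re R : C
  -> R)).
  exact: (@norm_continuous _ C).
exact: continuous_Re.
Qed.

Lemma normE (z : R[i]) : `|z| = (complex.Re `|z|)%:C.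
Proof. by rewrite normc_def. Qed.

Lemma open_notin (s : seq C) : open [set z : C | z \notin s].
Proof.
elim: s => [|a s ih].
  have -> : [set z : C | z \notin [::]] = setT by apply/seteqP; split.
  exact: openT.
have -> : [set z : C | z \notin a :: s] = ~` [set a] `&` [set z | z \notin s].
  apply/seteqP; split => z /=; rewrite inE negb_or.
    by move=> /andP[/eqP].
  by move=> [/eqP-> ->].
apply: openI => //; rewrite openC.
exact: (accessible_closed_set1 (hausdorff_accessible (@norm_hausdorff _ C))).
Qed.

Lemma unit_homotopic_radial (X : set C) (a : C) (rho : R) (h : C -> C) :
  0 < rho -> ~ X a -> (forall z, z != a -> `|z - a| <= rho%:C -> X z) ->
  unit_on X h ->
  unit_homotopic X h
    (fun z => h (a + (z - a) * (Num.max 1 (rho / complex.Re `|z - a|))%:C)) /\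
  unit_on X
    (fun z => h (a + (z - a) * (Num.max 1 (rho / complex.Re `|z - a|))%:C)).
Proof.
move=> rho0 Xa aX uh.
(* The factor pushes the points within rho of a outwards, up to the circle at time 1, and fixes the
   others. Time is any real: the inner [min] stops the push at the circle, so that the path never
   leaves X, and the outer [max] makes it the identity for t <= 0. *)
pose m (p : R * C) : R := Num.max 1 (Num.min p.1 1 * (rho / complex.Re `|p.2 -
  a|)).
pose sg (p : R * C) : C := a + (p.2 - a) * (m p)%:C.
have XaP z : X z -> z != a by move=> Xz; apply/eqP => za; apply: Xa; rewrite -za.
have r0 z : X z -> 0 < complex.Re `|z - a|.
  by move=> /XaP za; rewrite -ltcR -normE normr_gt0 subr_eq0.
have sgX t z : X z -> X (sg (t, z)).
  move=> Xz; have za := XaP z Xz; have rz := r0 z Xz.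
  have m1 : 1 <= m (t, z) by rewrite le_max lexx.
  have q0 : 0 <= rho / complex.Re `|z - a| by rewrite divr_ge0 ?ltW.
  have t1 : Num.min t 1 <= 1 by rewrite ge_min lexx orbT.
  have [rle|rlt] := leP rho (complex.Re `|z - a|).
    suff -> : sg (t, z) = z by [].
    rewrite /sg; suff -> : m (t, z) = 1 by rewrite mulr1 addrC subrK.
    apply: max_l; rewrite /= (le_trans (y := rho / complex.Re `|z - a|))//.
      exact: ler_piMl.
    by rewrite ler_pdivrMr// mul1r.
  apply: aX; rewrite /sg /=.
    rewrite -subr_eq0 addrC addKr mulf_neq0 ?subr_eq0//.
    by rewrite -[0]/(0%:C) (inj_eq (@complexI R)) gt_eqF// (lt_le_trans ltr01).
  rewrite addrC addKr normrM norm_real_complex normE -rmorphM lecR.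
  rewrite (ger0_norm (le_trans ler01 m1)) -ler_pdivlMl// ge_max.
  rewrite mulrC ler_pdivlMr// mul1r ltW//=.
  exact: ler_piMl.
have csg t z : X z -> {for (t, z), continuous sg}.
  move=> Xz; apply: continuous_atD; first exact: continuous_at_cst.
  have c2 : {for (t, z), continuous (fun p : R * C => p.2 - a : C)}.
    by apply: continuous_atD; [exact: cvg_snd|exact: continuous_at_cst].
  apply: (continuous_atM c2).
  apply: (@continuous_at_comp _ (t, z) _ _ m (fun x : R => x%:C : C));
    last exact: continuous_real_complex.
  apply: (@continuous_max R _ (cst 1) (fun p : R * C => Num.min p.1 1 * (rho /
    complex.Re `|p.2 - a|))).
    exact: cvg_cst.
  apply: (@continuousM _ _ (fun p : R * C => Num.min p.1 1)
    (fun p : R * C => rho / complex.Re `|p.2 - a|)).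
    apply: (@continuous_min R _ (fst : R * C -> R) (cst 1)); first exact: cvg_fst.
    exact: cvg_cst.
  apply: (@continuousM _ _ (cst rho) (fun p : R * C => (complex.Re `|p.2 -
    a|)^-1)).
    exact: cvg_cst.
  apply: (@continuousV _ _ (fun p : R * C => complex.Re `|p.2 - a|)).
    by rewrite gt_eqF//= r0.
  exact: (continuous_at_comp c2 (@continuous_norm _)).
have H1 z : X z -> sg (1, z) = a + (z - a) * (Num.max 1 (rho / complex.Re `|z -
  a|))%:C.
  by rewrite /sg /m /= minxx mul1r.
have cHp t z : X z -> {for (t, z), continuous (fun p => h (sg p))}.
  move=> Xz; apply: (continuous_at_comp (csg t z Xz)).
  by have [] := uh _ (sgX t z Xz).
split.
  exists (fun p => h (sg p)); split => [t z Xz|z Xz|z Xz].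
  - by split; [have [] := uh _ (sgX t z Xz)|exact: cHp].
  - rewrite /sg /m /= min_l// mul0r max_l// mulr1 addrC subrK//.
  - by rewrite H1.
move=> z Xz; rewrite -H1//; split; first by have [] := uh _ (sgX 1 z Xz).
have -> : (fun z => h (a + (z - a) * (Num.max 1 (rho / complex.Re `|z -
  a|))%:C)) =
    (fun z => h (sg (1, z))).
  by apply/funext => y; rewrite /sg /m /= minxx mul1r.
apply: (@continuous_at_comp _ z (R * C)%type C (fun z : C => (1 : R, z)) (fun p
  => h (sg p)));
  last exact: cHp.
apply: (@continuous_at_pair C z R C (cst 1) id); last exact: cvg_id.
exact: cst_continuous.
Qed.

End Classification.

(** * Removing the punctures one at a time *)

Section Induction.
Local Open Scope complex_scope.
Variable R : realType.
Local Notation C := (R[i]^o).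

Lemma local_form (X : set C) (a : C) (rho : R) (h : C -> C) :
  0 < rho -> (forall z, z != a -> `|z - a| <= rho%:C -> X z) -> unit_on X h ->
  exists (k : int) (g : C -> C),
    (forall z, z != a -> {for z, continuous g}) /\
    forall z, z != a -> `|z - a| <= rho%:C ->
      h (a + (z - a) * (Num.max 1 (rho / complex.Re `|z - a|))%:C) =
      (z - a) ^ k * cexp (g z).
Proof.
move=> rho0 aX uh.
pose circ (t : R) : C := a + rho%:C * cexp (0 +i* t).
have circ_norm t : `|circ t - a| = rho%:C.
  by rewrite /circ addrC addKr normrM norm_cexp_i mulr1 norm_real_complex
    gtr0_norm.
have circX t : X (circ t).
  apply: aX; last by rewrite circ_norm.
  by rewrite -subr_eq0 -normr_eq0 circ_norm (inj_eq (@complexI R)) gt_eqF.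
have cimag : continuous (fun t : R => 0 +i* t : C).
  move=> t; apply: (@continuous_Complex R R (cst 0) id); first exact: cvg_cst.
  exact: cvg_id.
have ccirc : continuous circ.
  move=> t; apply: continuous_atD; first exact: continuous_at_cst.
  apply: continuous_atM; first exact: continuous_at_cst.
  apply: (continuous_at_comp (cimag t)); exact: continuous_cexp.
have [k [g [cg gE]]] := @winding_number R (fun t => h (circ t))
  (fun t => continuous_at_comp (ccirc t) (uh _ (circX t)).2)
  (fun t => (uh _ (circX t)).1)
  (fun t => congr1 (fun z => h (a + rho%:C * z))
     (etrans (cexp_i _) (etrans (f_equal2 (@Complex R) (cosD2pi t) (sinD2pi t))
       (esym (cexp_i t))))).
exists k, (fun z => g (z - a)); split => [z za|z za zr].
  apply: (@continuous_at_comp C z C C (fun z : C => z - a : C) g).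
    by apply: continuous_atD; [exact: cvg_id|exact: continuous_at_cst].
  by apply: cg; rewrite subr_eq0.
have za0 : z - a != 0 by rewrite subr_eq0.
(* As w is a logarithm of z - a, the radial push sends z to the point of the circle of angle Im
   w. *)
have [w wE <-] := gE _ za0; congr (h _); rewrite /circ; congr (_ + _).
have nE : complex.Re `|z - a| = expR (complex.Re w) by rewrite -wE norm_cexp.
have rz : expR (complex.Re w) <= rho by rewrite -nE -lecR -normE.
rewrite nE max_r; last by rewrite ler_pdivlMr ?expR_gt0// mul1r.
rewrite -wE cexp_polar mulrAC -rmorphM /=; congr (_%:C * _).
by rewrite mulrCA divff ?mulr1// gt_eqF// expR_gt0.
Qed.

Lemma unit_homotopic_extension (X : set C) (a : C) (rho : R) (h : C -> C) :
  0 < rho -> ~ X a -> open X ->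
  (forall z, z != a -> `|z - a| <= rho%:C -> X z) -> unit_on X h ->
  exists (k : int) (h2 : C -> C), unit_on (X `|` [set a]) h2 /\
    unit_homotopic X h (fun z => h2 z * (z - a) ^ k).
Proof.
move=> rho0 Xa oX aX uh.
have [k [g [cg gE]]] := local_form rho0 aX uh.
have [hom1 u1] := unit_homotopic_radial rho0 Xa aX uh.
set h1 := fun z => h _ in hom1 u1 gE.
have XaP z : X z -> z != a by move=> Xz; apply/eqP => za; apply: Xa; rewrite -za.
have cgN z : X z -> {for z, continuous (fun z => - g z : C)}.
  by move=> /XaP za; apply: continuous_atN; exact: cg.
have uk (j : int) : unit_on X (fun z => (z - a) ^ j).
  move=> z /XaP za; have za0 : z - a != 0 by rewrite subr_eq0.
  split; first by rewrite expfz_neq0.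
  apply: (@continuous_atXz R C z (fun z => z - a) _ za0).
  by apply: continuous_atD; [exact: cvg_id|exact: continuous_at_cst].
pose f z := h1 z * (z - a) ^ (- k) * cexp (- g z).
have uf : unit_on X f.
  exact: (unit_onM (unit_onM u1 (uk (- k))) (unit_on_cexp cgN)).
(* By the local form f is identically 1 on the punctured disc of radius rho, so the value 1 extends
   it continuously to a. *)
pose h2 z := if z == a then 1 else f z.
exists k, h2; split.
  move=> z [Xz|->].
    have za := XaP z Xz; have [f0 cf] := uf z Xz.
    rewrite /h2 (negbTE za); split; first exact: f0.
    apply: continuous_at_near cf.
    have nX : \forall y \near z, X y by exact: open_nbhs_nbhs.
    by apply: filterS nX => y /XaP ya; rewrite (negbTE ya).
  split; first by rewrite /h2 eqxx oner_neq0.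
  apply: (@continuous_at_near _ _ _ (fun=> 1 : C)); last exact: continuous_at_cst.
  have rho0C : 0 < rho%:C by rewrite ltcR.
  have := @nbhsx_ballx _ C a _ rho0C.
  apply: (@filterS _ (nbhs (a : C)) _) => y; rewrite /ball /= => ya.
  rewrite /h2; have [//|y_neq_a] := eqVneq y a.
  have ya0 : y - a != 0 by rewrite subr_eq0.
  have -> : f y = (y - a) ^ k * cexp (g y) * (y - a) ^ (- k) * cexp (- g y).
    by rewrite /f -gE// distrC ltW.
  rewrite cexpN [_ * _ * _ ^ _]mulrAC mulfK ?cexp_neq0//.
  by rewrite -invr_expz mulfV// expfz_neq0.
apply: (unit_homotopic_trans u1 hom1).
apply: (unit_homotopic_eq (unit_homotopic_cexp u1 cgN)) => z Xz.
have za := XaP z Xz; have za0 : z - a != 0 by rewrite subr_eq0.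
rewrite /h2 (negbTE za) /f -invr_expz [RHS]mulrAC; congr (_ * _).
by rewrite mulfVK// expfz_neq0.
Qed.

Lemma unit_classification (s : seq C) (h : C -> C) : uniq s ->
  unit_on [set z | z \notin s] h ->
  exists k : C -> int, unit_homotopic [set z | z \notin s] h
    (fun z => \prod_(a <- s) (z - a) ^ k a).
Proof.
elim: s h => [|a s ih] h.
  move=> _ uh; exists (fun=> 0).
  have [c cE _] := cexp_surj (uh 0 isT).1.
  have ucst (d : C) : d != 0 -> unit_on [set z | z \notin [::]] (fun=> d : C).
    by move=> d0 z _; split; [exact: d0|exact: continuous_at_cst].
  (* Without punctures the plane contracts to 0; the constant h 0 is then moved to 1, the empty
     product, through its logarithm c. *)
  have hom : unit_homotopic [set z | z \notin [::]] h (fun=> h 0).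
    exists (fun p => h ((1 - p.1)%:C * p.2)); split => [t z _|z _|z _] /=.
    - have [h0 ch] := uh ((1 - t)%:C * z) isT; split; first exact: h0.
      apply: (@continuous_at_comp _ (t, z) C C (fun p => (1 - p.1)%:C * p.2 :
        C) h); last exact: ch.
      apply: continuous_atM; last exact: cvg_snd.
      apply: (@continuous_at_comp _ (t, z) _ _ (fun p => 1 - p.1) (fun x : R =>
        x%:C : C));
        last exact: continuous_real_complex.
      apply: (@cvgB _ R _ _ _ (cst 1) fst); first exact: cvg_cst.
      exact: cvg_fst.
    - by rewrite subr0 mul1r.
    - by rewrite subrr mul0r.
  have uh0 := ucst _ (uh 0 isT).1.
  apply: (unit_homotopic_trans uh0 hom).
  apply: (unit_homotopic_eq (unit_homotopic_cexp (g := fun=> - c) uh0 _)).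
    by move=> z _; exact: continuous_at_cst.
  by move=> z _; rewrite big_nil cexpN cE mulfV// (uh 0 isT).1.
move=> /= /andP[a_notin us] uh.
have : nbhs a [set z : C | z \notin s].
  by apply: open_nbhs_nbhs; split => //; exact: open_notin.
move=> /nbhs_ballP[_ /gt0_complexP[r r0 ->] rP].
have r20 : 0 < r / 2 by rewrite divr_gt0.
have aX z : z != a -> `|z - a| <= (r / 2)%:C -> z \notin a :: s.
  move=> za zr; rewrite inE negb_or za; apply: rP.
  rewrite /ball /= distrC (le_lt_trans zr)// ltcR ltr_pdivrMr// ltr_pMr// ltr1n.
  by [].
have Xa : ~ (a \notin a :: s) by rewrite inE eqxx.
have [k [h2 [u2 hom]]] :=
  unit_homotopic_extension r20 Xa (@open_notin R (a :: s)) aX uh.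
have sub : [set z | z \notin s] `<=` [set z | z \notin a :: s] `|` [set a].
  move=> z /= zs; have [->|za] := eqVneq z a; first by right.
  by left; rewrite /= inE negb_or za.
have [k' hom'] := ih h2 us (fun z zs => u2 z (sub z zs)).
exists (fun b => if b == a then k else k' b).
have uk : unit_on [set z | z \notin a :: s] (fun z => (z - a) ^ k).
  move=> z /=; rewrite inE negb_or => /andP[za _].
  have za0 : z - a != 0 by rewrite subr_eq0.
  split; first by rewrite expfz_neq0.
  apply: (@continuous_atXz R C z (fun z => z - a) _ za0).
  by apply: continuous_atD; [exact: cvg_id|exact: continuous_at_cst].
have u3 : unit_on [set z | z \notin a :: s] (fun z => h2 z * (z - a) ^ k).
  by apply: (unit_onM _ uk) => z Xz; apply: u2; left.
apply: (unit_homotopic_trans u3 hom).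
have sub2 : [set z | z \notin a :: s] `<=` [set z | z \notin s].
  by move=> z /=; rewrite inE negb_or => /andP[].
apply: (unit_homotopic_eq (unit_homotopicM uk (unit_homotopicW sub2 hom'))).
move=> z _; rewrite big_cons eqxx mulrC; congr (_ * _).
rewrite big_seq [RHS]big_seq; apply: eq_bigr => b bs.
by case: eqP => // ba; move: a_notin; rewrite -ba bs.
Qed.

End Induction.

(** * Elimination *)

Section Elimination.
Variable K : numClosedFieldType.
Implicit Types (A B P Q : {poly K}) (f g : {poly {poly K}}).

(** Here f and g are polynomials in y over K[x]. Their resultant lies in the ideal they generate,
    hence vanishes at the x of every common zero. As the leading coefficients survive at x0, its
    value there is the resultant of two coprime polynomials, which is nonzero. *)
Lemma elimination f g (x0 : K) :
  (1 < size f)%N -> (1 < size g)%N ->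
  (lead_coef f).[x0] != 0 -> (lead_coef g).[x0] != 0 ->
  coprimep (map_poly (horner_eval x0) f) (map_poly (horner_eval x0) g) ->
  exists2 d : {poly K}, d != 0 &
    forall x y, f.[y%:P].[x] = 0 -> g.[y%:P].[x] = 0 -> d.[x] = 0.
Proof.
move=> sf sg lf lg cop; exists (resultant f g).
  apply/eqP => res0; have := map_resultant (f := horner_eval x0) lf lg.
  rewrite res0 rmorph0 => /esym/eqP; rewrite resultant_eq0.
  by move: cop; rewrite /coprimep => /eqP ->.
move=> x y fxy gxy; have [[u v] /= _ E] := resultant_in_ideal sf sg.
have := congr1 (fun h : {poly {poly K}} => h.[y%:P].[x]) E.
by rewrite !hornerE fxy gxy !mulr0 addr0.
Qed.

(** The numerator of P/Q (x) - P/Q (y), with y the outer variable. *)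
Definition cross P Q : {poly {poly K}} := P%:P * Q^:P - Q%:P * P^:P.

Lemma cross_at P Q x y : (cross P Q).[y%:P].[x] = P.[x] * Q.[y] - Q.[x] * P.[y].
Proof.
have hC (p : {poly K}) : p^:P.[y%:P] = (p.[y])%:P by rewrite horner_map.
by rewrite /cross !hornerE !hC !hornerE.
Qed.

Lemma map_cross P Q x0 :
  map_poly (horner_eval x0) (cross P Q) = P.[x0] *: Q - Q.[x0] *: P.
Proof.
have mP p : map_poly (horner_eval x0) p^:P = p.
  by apply/polyP => i; rewrite !coef_map /= /horner_eval hornerC.
by rewrite /cross rmorphB !rmorphM /= !mP !map_polyC /= !mul_polyC.
Qed.

(** Provides the factor y - x to be divided out before elimination. *)
Lemma cross_diag P Q : root (cross P Q) 'X.
Proof.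
have hX (p : {poly K}) : p^:P.['X] = p by rewrite -[RHS]comp_polyXr.
by rewrite /root /cross !hornerE !hX mulrC subrr.
Qed.

Lemma deriv_cross_neq0 A B (w : K) :
  A^`() * B - A * B^`() != 0 -> B.[w] != 0 -> B.[w] *: A - A.[w] *: B != 0.
Proof.
move=> N0 Bw; apply: contraNneq N0 => /eqP; rewrite subr_eq0 => /eqP e.
have -> : A = (A.[w] / B.[w]) *: B.
  by rewrite mulrC -scalerA -e scalerA mulVf// scale1r.
by rewrite derivZ -!scalerAl [B * _]mulrC subrr.
Qed.

(* P has the two roots x0 (simple) and w; the fibre of (P/Q, A/B) through x0
   is {x0} as soon as A/B separates x0 from w, so that the resultant of the
   two equations of the double point locus does not vanish at x0. *)
Lemma generic_numerator A B Q n :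
  (0 < n)%N -> Q \is monic -> size Q = n.+1 ->
  A^`() * B - A * B^`() != 0 ->
  exists P, [/\ size P = n.+2,
    forall z, Q.[z] = 0 -> P.[z] != 0,
    forall z, Q.[z] != 0 -> (A^`() * B - A * B^`()).[z] = 0 ->
      (P^`() * Q - P * Q^`()).[z] != 0 &
    exists2 d : {poly K}, d != 0 &
      forall x y, x != y -> A.[x] * B.[y] = B.[x] * A.[y] ->
        P.[x] * Q.[y] = Q.[x] * P.[y] -> d.[x] = 0].
Proof.
move=> n0 monQ sQ; set N := _ - _ => N0.
have B0 : B != 0 by apply: contraNneq N0 => B0; rewrite /N B0 deriv0 !mulr0 subrr.
have Q0 : Q != 0 by apply: monic_neq0.
(* N(w) != 0 keeps w away from the critical points of A/B, B(w) != 0 makes A/B defined at w, and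
   Q(w) != 0 keeps w out of the poles. *)
have [w] : exists w, ~~ root (N * B * Q) w.
  by apply/closed_nonrootP; rewrite !mulf_neq0.
rewrite !rootM !negb_or => /andP[/andP[Nw Bw] Qw].
pose f := cross A B.
have e1 := deriv_cross_neq0 N0 Bw.
have f0 : f != 0.
  apply: contraNneq e1 => f0; apply/eqP; apply/polyP => i.
  have -> : B.[w] *: A - A.[w] *: B = f.[w%:P].
    have hC (p : {poly K}) : p^:P.[w%:P] = (p.[w])%:P by rewrite horner_map.
    by rewrite /f /cross !hornerE !hC -!mul_polyC mulrC [B * _]mulrC.
  by rewrite f0 horner0.
have [rs Nrs] := closed_field_poly_normal N.
(* Up to the factor (z - w)^(n-1), this is the numerator of (P/Q)' at z, seen as a polynomial in the
   unknown x0. It is nonzero because its value at x0 = z is (z - w) Q(z). *)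
pose L (z : K) : {poly K} := ((z - w) * Q.[z])%:P +
  (z%:P - 'X) * (n%:R * Q.[z] - (z - w) * Q^`().[z])%:P.
pose LL := \prod_(z <- rs | Q.[z] != 0) L z.
have LL0 : LL != 0.
  rewrite /LL prodf_seq_neq0; apply/allP => z zrs; apply/implyP => Qz.
  apply/eqP => /(congr1 (fun p => p.[z])); rewrite /L !hornerE subrr mul0r addr0.
  apply/eqP; rewrite mulf_neq0// subr_eq0; apply: contraNneq Nw => <-.
  by rewrite Nrs rootZ ?lead_coef_eq0// root_prod_XsubC.
(* The four factors ensure that A/B separates x0 from w, that the leading coefficient of f survives
   at x0, that x0 is not a pole, and that P/Q is immersive at the critical points of A/B. *)
have [x0] : exists x, ~~ root ((B.[w] *: A - A.[w] *: B) * lead_coef f * Q *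
  LL) x.
  by apply/closed_nonrootP; rewrite !mulf_neq0// lead_coef_eq0.
rewrite !rootM !negb_or => /andP[/andP[/andP[Ex lfx] Qx] Lx].
pose P := ('X - x0%:P) * ('X - w%:P) ^+ n.
have sP : size P = n.+2.
  by rewrite /P size_Mmonic ?polyXsubC_eq0 ?monic_exp ?monicXsubC// size_XsubC
    size_exp_XsubC.
have monP : P \is monic by rewrite /P monicMl ?monic_exp ?monicXsubC.
exists P; split => //.
- move=> z Qz; rewrite /P !hornerE mulf_neq0 ?expf_neq0// subr_eq0.
    by apply: contraNneq Qx => <-; rewrite /root Qz.
  by apply: contraNneq Qw => <-; rewrite /root Qz.
- move=> z Qz Nz; have zw : z - w != 0.
    by rewrite subr_eq0; apply: contraNneq Nw => <-; rewrite /root Nz.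
  have zrs : z \in rs.
    by rewrite -root_prod_XsubC -(rootZ _ (a := lead_coef N)) -?Nrs
      ?lead_coef_eq0// /root Nz.
  have : (L z).[x0] != 0.
    move: Lx; rewrite /LL /root horner_prod prodf_seq_neq0 => /allP/(_ z zrs).
    by rewrite Qz.
  have -> : (P^`() * Q - P * Q^`()).[z] = (z - w) ^+ n.-1 * (L z).[x0].
    rewrite /P /L derivM derivXsubC mul1r deriv_exp derivXsubC !hornerE.
    case: (n) n0 => // m _ /=.
    by rewrite hornerMn horner_exp hornerXsubC -mulr_natr exprS; ring.
  by move=> Lz; rewrite mulf_neq0// expf_neq0.
- have /factor_theorem[g gE] := cross_diag P Q.
  have P0 : P != 0 by apply: monic_neq0.
  (* As deg P > deg Q, the leading term in y of the cross polynomial comes from - Q(x) P(y) alone;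
     its coefficient - Q is nonzero at x0. *)
  have lP : lead_coef (- (Q%:P * P^:P)) = - Q.
    rewrite lead_coefN lead_coefM lead_coefC.
    by rewrite (lead_coef_map_inj (@polyC_inj _)) ?rmorph0// (monicP monP) mulr1.
  have smP (p r : {poly K}) : r != 0 -> size (r%:P * p^:P) = size p.
    by move=> r0; rewrite size_Cmul// size_map_polyC.
  have sPQ : (size (P%:P * Q^:P)%R < size (- (Q%:P * P^:P))%R)%N.
    by rewrite size_polyN !smP// sP sQ.
  have lG : lead_coef (cross P Q) = - Q by rewrite /cross lead_coefDr.
  have sG : size (cross P Q) = n.+2.
    by rewrite /cross addrC size_polyDl// size_polyN smP.
  have g0 : g != 0.
    by apply: contra_eqN sG => /eqP g0; rewrite gE g0 mul0r size_poly0.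
  have lg : lead_coef g = - Q.
    by rewrite -lG gE lead_coefM lead_coefXsubC mulr1.
  have sg : size g = n.+1.
    by move: sG; rewrite gE size_mul ?polyXsubC_eq0// size_XsubC addn2 => -[].
  (* P vanishes at x0, so the cross polynomial specialises to - Q(x0) P(y); dividing by y - x0
     leaves w as the only root. Coprimality with f then reduces to f(x0, w) != 0. *)
  have mg : map_poly (horner_eval x0) g = - Q.[x0] *: ('X - w%:P) ^+ n.
    have X0 : 'X - x0%:P != 0 by rewrite polyXsubC_eq0.
    apply: (mulIf X0); have := congr1 (map_poly (horner_eval x0)) gE.
    rewrite map_cross rmorphM rmorphB /= map_polyX map_polyC /= /horner_eval
      hornerX => <-.
    rewrite {1}/P !hornerE subrr mul0r scale0r sub0r scaleNr /P.
    by rewrite mulNr -scalerAl [_ ^+ n * _]mulrC.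
  (* If f were constant in y, its vanishing on the diagonal would make it zero. *)
  have sf : (1 < size f)%N.
    rewrite ltnNge; apply: contraNN f0 => /size1_polyC fE.
    have := cross_diag A B; rewrite -/f fE /root hornerC => /eqP ->.
    by rewrite polyC0.
  have [||||d d0 dP] := @elimination f g x0 sf.
  - by rewrite sg.
  - exact: lfx.
  - by rewrite lg hornerN oppr_eq0.
  - rewrite mg coprimepZr ?oppr_eq0// map_cross coprimep_expr//.
    rewrite coprimep_XsubC /root !hornerE; move: Ex; rewrite /root !hornerE.
    by rewrite mulrC [X in _ - X]mulrC.
  exists d => // x y xy e1' e2; apply: (dP x y).
    by rewrite cross_at e1' subrr.
  have := cross_at P Q x y; rewrite e2 subrr gE !hornerE => /eqP.
  by rewrite mulf_eq0 subr_eq0 [y == x]eq_sym (negbTE xy) orbF => /eqP.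
Qed.

End Elimination.

(** * Rational functions with prescribed zeros and poles *)

Section RationalFunctions.
Variable K : numClosedFieldType.

Definition pos_part (k : int) : nat := if k is Posz m then m else 0.
Definition neg_part (k : int) : nat := if k is Negz m then m.+1 else 0.

Lemma exprz_parts (z : K) k : z ^ k = z ^+ pos_part k / z ^+ neg_part k.
Proof. by case: k => m; rewrite /= ?expr0 ?divr1 ?div1r. Qed.

Variables (n : nat) (a : 'I_n -> K).

Definition pole_poly : {poly K} := \prod_i ('X - (a i)%:P).
Definition num_poly (k : 'I_n -> int) : {poly K} :=
  \prod_i ('X - (a i)%:P) ^+ pos_part (k i).
Definition den_poly (k : 'I_n -> int) : {poly K} :=
  \prod_i ('X - (a i)%:P) ^+ neg_part (k i).

Lemma pole_poly_monic : pole_poly \is monic.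
Proof. exact: monic_prod_XsubC. Qed.

Lemma size_pole_poly : size pole_poly = n.+1.
Proof. by rewrite size_prod_XsubC /index_enum -enumT size_enum_ord. Qed.

Lemma pole_poly_eq0 z : (pole_poly.[z] == 0) = [exists i, z == a i].
Proof.
rewrite horner_prod; apply/eqP/existsP => [/eqP/prodf_eq0[i _]|[i /eqP ->]].
  by rewrite hornerXsubC subr_eq0; exists i.
by rewrite (bigD1 i)//= hornerXsubC subrr mul0r.
Qed.

Lemma num_poly_eq0 k z : pole_poly.[z] != 0 -> (num_poly k).[z] != 0.
Proof.
rewrite pole_poly_eq0 => /existsPn zi; rewrite horner_prod.
apply/prodf_neq0 => i _.
by rewrite horner_exp hornerXsubC expf_neq0// subr_eq0.
Qed.

Lemma den_poly_eq0 k z : pole_poly.[z] != 0 -> (den_poly k).[z] != 0.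
Proof.
rewrite pole_poly_eq0 => /existsPn zi; rewrite horner_prod.
apply/prodf_neq0 => i _.
by rewrite horner_exp hornerXsubC expf_neq0// subr_eq0.
Qed.

Lemma prod_exprz k z :
  \prod_i (z - a i) ^ k i = (num_poly k).[z] / (den_poly k).[z].
Proof.
rewrite !horner_prod -prodf_div; apply: eq_bigr => i _.
by rewrite exprz_parts !horner_exp hornerXsubC.
Qed.

Lemma coprime_num_den k : injective a -> coprimep (num_poly k) (den_poly k).
Proof.
move=> ai; rewrite /den_poly; apply: (big_ind (coprimep (num_poly k))).
- exact: coprimep1.
- by move=> p q cp cq; rewrite coprimepMr cp cq.
move=> j _; rewrite /num_poly; apply: (big_ind (fun p => coprimep p _)).
- exact: coprime1p.
- by move=> p q cp cq; rewrite coprimepMl cp cq.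
move=> i _.
have [->|ij] := eqVneq i j.
  by case: (k j) => m; rewrite /= expr0 ?coprimep1 ?coprime1p.
apply: coprimep_expr; apply: coprimep_expl.
rewrite coprimep_XsubC root_XsubC; apply: contra ij => /eqP/ai ->.
by [].
Qed.

Lemma deriv_eq0_size1 (p : {poly K}) : p^`() = 0 -> (size p <= 1)%N.
Proof.
move=> p'0; rewrite leqNgt; apply/negP => sp.
have := congr1 (fun q : {poly K} => q`_(size p).-2) p'0.
rewrite coef_deriv coef0 /=; have -> : (size p).-2.+1 = (size p).-1 by lia.
move/eqP; rewrite mulrn_eq0; have -> : ((size p).-1 == 0)%N = false by lia.
by rewrite -lead_coefE lead_coef_eq0 => /eqP p0; move: sp; rewrite p0 size_poly0.
Qed.

Lemma dvdp_deriv_size1 (p : {poly K}) : p %| p^`() -> (size p <= 1)%N.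
Proof.
move=> pp'; apply: deriv_eq0_size1; apply/eqP; apply: contraT => p'0.
have p0 : p != 0 by apply: contraNneq p'0 => ->; rewrite deriv0.
by have := dvdp_leq p'0 pp'; rewrite leqNgt lt_size_deriv.
Qed.

(** If A' B = A B' with A and B coprime, then A divides A' and B divides B', so both are constant by
    degree. But a nonzero exponent k_i makes a_i a root of one of them. *)
Lemma wronskian_neq0 k : injective a -> (exists i, k i != 0) ->
  (num_poly k)^`() * den_poly k - num_poly k * (den_poly k)^`() != 0.
Proof.
move=> ai [i ki]; apply/eqP => /eqP; rewrite subr_eq0 => /eqP E.
have cop := coprime_num_den k ai.
have sA : (size (num_poly k) <= 1)%N.
  apply: dvdp_deriv_size1; rewrite -(Gauss_dvdpl _ cop) E.
  exact: dvdp_mulr.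
have sB : (size (den_poly k) <= 1)%N.
  apply: dvdp_deriv_size1; rewrite coprimep_sym in cop.
  by rewrite -(Gauss_dvdpr _ cop) -E dvdp_mull.
have root_size1 (p : {poly K}) : p != 0 -> root p (a i) -> (size p <= 1)%N ->
  False.
  move=> p0 rp sp; have := root_size_gt1 p0 rp; lia.
have An0 : num_poly k != 0.
  by apply/prodf_neq0 => j _; rewrite expf_neq0// polyXsubC_eq0.
have Bn0 : den_poly k != 0.
  by apply/prodf_neq0 => j _; rewrite expf_neq0// polyXsubC_eq0.
case ki_eq : (k i) ki => [m|m] m0.
  apply: (root_size1 _ An0 _ sA); rewrite /root horner_prod (bigD1 i)//= ki_eq /=.
  rewrite horner_exp hornerXsubC subrr expr0n.
  by case: m m0 {ki_eq} => //= m _; rewrite mul0r.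
apply: (root_size1 _ Bn0 _ sB); rewrite /root horner_prod (bigD1 i)//= ki_eq /=.
by rewrite horner_exp hornerXsubC subrr expr0n mul0r.
Qed.

(** Equality would mean that z + 1/q is invariant under translation by c, that is qc - q = c q qc.
    The right side has degree 2n and the left at most n, so n = 0 and q = 1, where the identity
    reads 0 = c. *)
Lemma translate_cross_neq0 (c : K) : c != 0 ->
  let P := 'X * pole_poly + 1 in
  P * (pole_poly \Po ('X + c%:P)) - (P \Po ('X + c%:P)) * pole_poly != 0.
Proof.
move=> c0 /=; set q := pole_poly; set qc := q \Po _.
rewrite comp_polyD comp_polyM comp_polyX -[1]/(1%:P) comp_polyC -/qc.
have -> : ('X * q + 1%:P) * qc - (('X + c%:P) * qc + 1%:P) * q =
    (qc - q) - c *: (q * qc) by rewrite -mul_polyC; ring.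
rewrite subr_eq0; apply/eqP => E.
have q0 : q != 0 by exact: monic_neq0 pole_poly_monic.
have sc : size ('X + c%:P) = 2%N by rewrite size_XaddC.
have sqc : size qc = size q by rewrite /qc size_comp_poly2.
have qc0 : qc != 0 by rewrite -size_poly_eq0 sqc size_poly_eq0.
have sE := congr1 (fun p : {poly K} => size p) E.
rewrite /= size_scale// size_mul// sqc size_pole_poly in sE.
have := size_polyD qc (- q).
rewrite size_polyN sqc maxnn size_pole_poly sE => n1.
have n0 : n = 0%N by lia.
have q1 : q = 1.
  rewrite /q /pole_poly big1// => -[m lt_m] _; exfalso.
  by rewrite n0 in lt_m.
move: E; rewrite /qc q1 -[1]/(1%:P) comp_polyC subrr mulr1.
by move/esym/eqP; rewrite scaler_eq0 (negbTE c0) polyC_eq0 oner_eq0.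
Qed.

End RationalFunctions.

(** * Proper immersions *)

Section PolynomialGrowth.
Variable K : numFieldType.

Lemma norm_horner_le (u : {poly K}) d (z : K) : (size u <= d.+1)%N ->
  1 <= `|z| -> `|u.[z]| <= (\sum_(i < size u) `|u`_i|) * `|z| ^+ d.
Proof.
move=> su z1; rewrite horner_coef (le_trans (ler_norm_sum _ _ _))//.
rewrite mulr_suml; apply: ler_sum => i _; rewrite normrM normrX.
apply: ler_wpM2l => //; apply: ler_weXn2l => //.
by have := ltn_ord i; lia.
Qed.

(** The leading term of P has degree d + 1 and is bounded by |U| + M |Q|, where U is the rest of P
    and both U and Q have degree at most d; dividing by |z|^d bounds |z|. This is properness at
    infinity. *)
Lemma horner_growth (P Q : {poly K}) (M : K) : 0 <= M -> (1 < size P)%N ->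
  (size Q < size P)%N ->
  exists rho : K, forall z, `|P.[z]| <= M * `|Q.[z]| -> `|z| <= rho.
Proof.
move=> M0 sP sQ; pose d := (size P).-2.
have dE : size P = d.+2 by rewrite /d; lia.
pose U := P - lead_coef P *: 'X^(d.+1).
have sU : (size U <= d.+1)%N.
  apply/leq_sizeP => j dj; rewrite coefB coefZ coefXn.
  have [->|jd] := eqVneq j d.+1; first by rewrite mulr1 lead_coefE dE subrr.
  by rewrite mulr0 subr0 nth_default// dE; lia.
pose S := \sum_(i < size U) `|U`_i| + M * \sum_(i < size Q) `|Q`_i|.
have S0 : 0 <= S by rewrite addr_ge0 ?mulr_ge0 ?sumr_ge0.
have lP : 0 < `|lead_coef P|.
  by rewrite normr_gt0 lead_coef_eq0 -size_poly_gt0 dE.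
(* The summand 1 covers the case |z| <= 1, where the comparison of powers fails. *)
exists (1 + S / `|lead_coef P|) => z zle.
have [z1|/ltW z1] := real_leP (normr_real z) (@real1 K).
  by rewrite (le_trans z1)// lerDl divr_ge0.
have zd : 0 < `|z| ^+ d by rewrite exprn_gt0// (lt_le_trans ltr01).
suff : `|z| <= S / `|lead_coef P|.
  by move=> /le_trans; apply; rewrite lerDr.
rewrite ler_pdivlMr// -(ler_pM2r zd) mulrAC -exprS mulrC.
have -> : `|lead_coef P| * `|z| ^+ d.+1 = `|P.[z] - U.[z]|.
  by rewrite /U !hornerE opprB addrC subrK normrM normrX.
rewrite (le_trans (ler_normB _ _))// addrC /S mulrDl lerD//.
  exact: norm_horner_le.
rewrite (le_trans zle)// -mulrA ler_wpM2l//; apply: norm_horner_le => //.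
by move: sQ; rewrite dE.
Qed.

Lemma is_derive_horner (p : {poly K}) (z : K) :
  is_derive z 1 (horner p) p^`().[z].
Proof.
elim/poly_ind: p => [|p c ih].
  have -> : horner (0 : {poly K}) = cst 0 by apply/funext => x; rewrite horner0.
  by rewrite deriv0 horner0; exact: is_derive_cst.
have -> : horner (p * 'X + c%:P) = (horner p * id) + cst c.
  by apply/funext => x; rewrite hornerMXaddC.
apply: is_derive_eq (is_deriveD (is_deriveM ih (is_derive_id z 1))
  (is_derive_cst c z 1)) _.
by rewrite derivD derivC derivM derivX !hornerE /GRing.scale /= mulr1 addrC mulrC.
Qed.

Lemma continuous_horner_num (p : {poly K}) : continuous (horner p).
Proof.
move=> z; apply: differentiable_continuous; apply/derivable1_diffP.
by have [] := is_derive_horner p z.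
Qed.

Lemma is_derive_quotient (P Q : {poly K}) (z : K) : Q.[z] != 0 ->
  is_derive z 1 (fun y => P.[y] / Q.[y])
    ((P^`() * Q - P * Q^`()).[z] / Q.[z] ^+ 2).
Proof.
move=> Qz; have dP := is_derive_horner P z; have dQ := is_derive_horner Q z.
have dV : is_derive z 1 (fun y => (horner Q y)^-1) (- (Q.[z]) ^- 2 *: Q^`().[z]).
  apply: DeriveDef; first by apply: derivableV.
  by rewrite deriveV// derive_val.
apply: is_derive_eq (is_deriveM dP dV) _.
by rewrite /GRing.scale /= hornerD hornerN !hornerM; field.
Qed.

Lemma diff_is_derive (f : K -> K) (z df u : K) :
  is_derive z 1 f df -> 'd f z u = u * df.
Proof.
by move=> [/derivable1_diffP fd <-]; rewrite (diff1E fd) derive1E.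
Qed.

End PolynomialGrowth.

(** * Maps whose first component is rational *)

Section ProperImmersion.
Local Open Scope complex_scope.
Variable R : realType.
Local Notation C := (R[i]^o).

Lemma closed_bounded_compact (A : set C) (M : R) : closed A ->
  (forall z, A z -> `|z| <= M%:C) -> compact A.
Proof.
move=> clA AM; pose f (p : R * R) : C := p.1 +i* p.2.
apply: (@subclosed_compact _ A (f @` (`[- M, M]%classic `*` `[- M,
  M]%classic))) => //.
  apply: continuous_compact; last by apply: compact_setX; exact: segment_compact.
  apply: continuous_subspaceT => p; apply: continuous_Complex;
    first exact: cvg_fst.
  exact: cvg_snd.
move=> z Az; have zM := AM z Az; exists (complex.Re z, complex.Im z); last first.
  by rewrite /f /=; case: (z).
split; rewrite /= in_itv /= -ler_norml -lecR.
  exact: le_trans (normc_ge_Re z) zM.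
exact: le_trans (normc_ge_Im z) zM.
Qed.

Lemma compact_fst_bounded (A : set (C * C)) : compact A ->
  exists2 M : R, 0 <= M & forall w, A w -> `|w.1| <= M%:C.
Proof.
move=> cA; pose f (w : C * C) : R := complex.Re `|w.1|.
have cf : continuous f.
  move=> w; apply: (@continuous_at_comp _ w _ _ fst (fun z : C => complex.Re
    `|z|)).
    exact: cvg_fst.
  exact: continuous_norm.
have : compact (f @` A).
  by apply: continuous_compact => //; exact: continuous_subspaceT.
move=> /compact_bounded [M [_ MP]].
have M1 : M < `|M| + 1 by rewrite ltr_pwDr// ler_norm.
exists (`|M| + 1); first by rewrite addr_ge0.
move=> w Aw; rewrite normE lecR.
have := MP _ M1 (f w); rewrite /= => /(_ (ex_intro2 _ _ w Aw erefl)).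
exact: le_trans (ler_norm _).
Qed.

(** A bound M on |P/Q| confines the preimage to the set |P| <= M |Q|. Written without division, this
    set is closed in the whole plane; it is bounded by growth and misses the zeros of Q, where P
    does not vanish. *)
Lemma proper_quotient (X : set C) (P Q : {poly R[i]}) (h : C -> C) :
  (1 < size P)%N -> (size Q < size P)%N ->
  (forall z, Q.[z] = 0 -> P.[z] != 0) ->
  X = [set z | Q.[z] != 0] -> unit_on X h ->
  proper_map X (CxCstar R) (fun z => (P.[z] / Q.[z] : C, h z)).
Proof.
move=> sP sQ PQ XE uh; set psi := fun z => _.
have chorner (p : {poly R[i]}) : continuous (horner p : C -> C).
  exact: continuous_horner_num.
have cpsi z : X z -> {for z, continuous psi}.
  move=> Xz; apply: continuous_at_pair; last exact: (uh z Xz).2.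
  apply: (continuous_atM (chorner P z)); apply: (continuous_atV _ (chorner Q z)).
  by move: Xz; rewrite XE.
split; first split.
- by apply: continuous_in_subspaceT => z /set_mem; exact: cpsi.
- by move=> z Xz; exact: (uh z Xz).1.
move=> A AY cA; have [M M0 AM] := compact_fst_bounded cA.
have MC0 : 0 <= M%:C by rewrite lecR.
have [rho rhoP] := horner_growth MC0 sP sQ.
pose C1 := [set z : C | `|P.[z]| <= M%:C * `|Q.[z]|].
have EC1 z : X z -> A (psi z) -> C1 z.
  rewrite XE => Qz /AM; rewrite /psi /= normrM normfV.
  by rewrite ler_pdivrMr ?normr_gt0.
have C1X z : C1 z -> X z.
  rewrite XE /C1 /=; apply: contraTneq => Qz; rewrite Qz normr0 mulr0.
  by rewrite normr_le0; exact: PQ.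
have clC1 : closed C1.
  pose f (z : C) : R := complex.Re `|P.[z]| - M * complex.Re `|Q.[z]|.
  have -> : C1 = f @^-1` [set x | x <= 0].
    apply/seteqP; split => z;
      rewrite /C1 /f /= subr_le0 (normE P.[z]) (normE Q.[z]);
      by rewrite -rmorphM lecR.
  apply: closed_comp; last exact: closed_le.
  have cnorm (p : {poly R[i]}) z :
      {for z, continuous (fun z : C => complex.Re `|p.[z]|)}.
    apply: (@continuous_at_comp C z C R (horner p : C -> C) (fun z : C =>
      complex.Re `|z|)).
      exact: chorner.
    exact: continuous_norm.
  move=> z _; apply: (@continuousB R R C (fun z : C => complex.Re `|P.[z]|)).
    exact: cnorm.
  apply: (@continuousM _ _ (cst M) (fun z : C => complex.Re `|Q.[z]|)).
    exact: cst_continuous.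
  exact: cnorm.
apply: (@closed_bounded_compact _ (complex.Re rho)).
  have clA : closed A by apply: compact_closed => //; exact: norm_hausdorff.
  (* Closedness must hold in the plane and not merely in X: a point of [C1] lies in X, where [psi]
     is continuous, and any other point has a neighbourhood disjoint from [C1], hence from the
     preimage. *)
  rewrite -[X in closed X]setCK; apply: open_closedC; rewrite openE => z nEz.
  have [C1z|nC1z] := pselect (C1 z).
    have nAz : (~` A) (psi z) by move=> Az; apply: nEz; split => //; exact: C1X.
    have : nbhs (psi z) (~` A).
      by apply: open_nbhs_nbhs; split => //; exact: closed_openC.
    move=> /(cpsi z (C1X z C1z)); apply: (@filterS _ (nbhs (z : C)) _) => y.
    by move=> nAy [_].
  have : nbhs z (~` C1) by apply: open_nbhs_nbhs; split => //;
    exact: closed_openC.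
  apply: (@filterS _ (nbhs (z : C)) _) => y nC1y [Xy Ay]; apply: nC1y.
  exact: EC1.
move=> z [Xz Az]; have := rhoP z (EC1 z Xz Az) => zr.
(* The bound [rho] is a priori complex; being comparable with 0 makes it real. *)
have : 0 <= rho by exact: le_trans zr.
by case: rho zr {rhoP} => x y zr; rewrite lecE /= => /andP[/eqP y0 _]; move: zr;
  rewrite y0.
Qed.

(** The differential is u -> (u p', u h'), injective as soon as one derivative is nonzero; thus P/Q
    has to be controlled only at the critical points of h. *)
Lemma proper_holomorphic_immersion_quotient
    (X : set C) (P Q : {poly R[i]}) (h dh : C -> C) :
  (1 < size P)%N -> (size Q < size P)%N ->
  (forall z, Q.[z] = 0 -> P.[z] != 0) ->
  X = [set z | Q.[z] != 0] ->
  (forall z, X z -> h z != 0) ->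
  (forall z, X z -> is_derive z (1 : C) h (dh z)) ->
  (forall z, X z -> dh z = 0 -> (P^`() * Q - P * Q^`()).[z] != 0) ->
  proper_holomorphic_immersion X (CxCstar R) (fun z => (P.[z] / Q.[z] : C, h z)).
Proof.
move=> sP sQ PQ XE h0 hD imm.
have hdiff z : X z -> differentiable h z.
  by move=> Xz; apply/derivable1_diffP; have [] := hD z Xz.
split.
  apply: proper_quotient => // z Xz; split; first exact: h0.
  exact: (differentiable_continuous (hdiff z Xz)).
pose p (z : C) : C := P.[z] / Q.[z].
pose dp (z : C) : C := (P^`() * Q - P * Q^`()).[z] / Q.[z] ^+ 2.
have pD z : X z -> is_derive z (1 : C) p (dp z).
  by rewrite XE => Qz; exact: is_derive_quotient.
have pdiff z : X z -> differentiable p z.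
  by move=> Xz; apply/derivable1_diffP; have [] := pD z Xz.
split => z Xz; first by apply: differentiable_pair; [exact: pdiff|exact: hdiff].
have dE := diff_pair (pdiff z Xz) (hdiff z Xz).
have pE w : 'd p z w = w * dp z := @diff_is_derive R[i] p z (dp z) w (pD z Xz).
have hE w : 'd h z w = w * dh z := @diff_is_derive R[i] h z (dh z) w (hD z Xz).
move=> u v e.
have e' : ('d p z u, 'd h z u) = ('d p z v, 'd h z v).
  exact: (etrans (esym (congr1 (fun k => k u) dE)) (etrans e (congr1 (fun k =>
    k v) dE))).
have e1 := etrans (esym (pE u)) (etrans (congr1 fst e') (pE v)).
have e2 := etrans (esym (hE u)) (etrans (congr1 snd e') (hE v)).
clear e e' pE hE dE.
have [dh0|dh_neq0] := eqVneq (dh z) 0; last by apply: (mulIf dh_neq0).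
suff : dp z != 0 by move=> dp0; apply: (mulIf dp0).
rewrite /dp mulf_neq0 ?imm// invr_neq0// expf_neq0//.
by move: Xz; rewrite XE.
Qed.

End ProperImmersion.

(** * The two kinds of homotopy classes *)

Section Assembly.
Local Open Scope complex_scope.
Variable R : realType.
Local Notation C := (R[i]^o).

Lemma unit_homotopic_sym (X : set C) h1 h2 :
  unit_homotopic X h1 h2 -> unit_homotopic X h2 h1.
Proof.
move=> [H [HX H0 H1]]; exists (fun p => H (1 - p.1, p.2)).
split => [t z Xz|z Xz|z Xz] /=.
- have [Hn cH] := HX (1 - t) z Xz; split; first exact: Hn.
  apply: (@continuous_at_comp _ (t, z) (R * C)%type C (fun p : R * C => (1 -
    p.1, p.2)) H);
    last exact: cH.
  apply: (@continuous_at_pair _ (t, z) R C (fun p : R * C => 1 - p.1) snd);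
    last exact: cvg_snd.
  apply: (@continuousB R R _ (cst 1) (fst : R * C -> R));
    first exact: cst_continuous.
  exact: cvg_fst.
- by rewrite subr0 H1.
- by rewrite subrr H0.
Qed.

(** First components are joined by segments, C being convex, so only the second components constrain
    the class. *)
Lemma homotopic_CxCstar (X : set C) (f1 f2 p r : C -> C) :
  (forall z, X z -> {for z, continuous f1}) ->
  (forall z, X z -> {for z, continuous p}) ->
  unit_homotopic X f2 r ->
  homotopic R X (CxCstar R) (fun z => (f1 z, f2 z)) (fun z => (p z, r z)).
Proof.
move=> cf1 cp [H [HX H0 H1]].
exists (fun w : R * C =>
  ((1 - w.1)%:C * f1 w.2 + w.1%:C * p w.2 : C, H (w.1, w.2))).
split; last 2 first.
- by move=> z Xz /=; rewrite subr0 mul1r mul0r addr0 H0.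
- by move=> z Xz /=; rewrite subrr mul0r mul1r add0r H1.
split; last by move=> [t z] [_ /= Xz]; exact: (HX t z Xz).1.
apply: continuous_in_subspaceT => -[t z] /set_mem[_ /= Xz].
have ct : {for (t, z), continuous (fun w : R * C => w.1%:C : C)}.
  apply: (@continuous_at_comp _ (t, z) R C fst (fun x : R => x%:C : C));
    first exact: cvg_fst.
  exact: continuous_real_complex.
have ct' : {for (t, z), continuous (fun w : R * C => (1 - w.1)%:C : C)}.
  apply: (@continuous_at_comp _ (t, z) R C (fun w : R * C => 1 - w.1) (fun x :
    R => x%:C : C));
    last exact: continuous_real_complex.
  apply: (@continuousB R R _ (cst 1) (fst : R * C -> R));
    first exact: cst_continuous.
  exact: cvg_fst.
have cH : {for (t, z), continuous (fun w : R * C => H (w.1, w.2))}.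
  have -> : (fun w : R * C => H (w.1, w.2)) = H by apply/funext => -[].
  exact: (HX t z Xz).2.
exact: (continuous_at_pair (continuous_atD (continuous_atM ct'
  (continuous_at_snd (cf1 z Xz))) (continuous_atM ct (continuous_at_snd (cp z
    Xz)))) cH).
Qed.

Lemma finite_roots (p : {poly R[i]}) : p != 0 -> finite_set [set z : C | p.[z]
  = 0].
Proof.
move=> p0; have [rs pE] := closed_field_poly_normal p.
apply: (@sub_finite_set _ _ [set` (rs : seq C)]); last exact: finite_seq.
move=> z /= /eqP; rewrite pE -/(root _ z) rootZ ?lead_coef_eq0//.
by rewrite root_prod_XsubC.
Qed.

Variables (n : nat) (a : 'I_n -> C).
Let X := punctured_plane a.
Let Q : {poly R[i]} := pole_poly a.

Lemma punctured_planeE : X = [set z | Q.[z] != 0].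
Proof.
apply/seteqP; split => z /=; rewrite /Q pole_poly_eq0.
  by move=> za; apply/existsPn => i; apply/eqP; exact: za.
by move=> /existsPn za i; apply/eqP; exact: za.
Qed.

Lemma punctured_plane_notin : X = [set z | z \notin [seq a i | i <- enum 'I_n]].
Proof.
apply/seteqP; split => z /=.
  by move=> za; apply/mapP => -[i _]; exact: za.
move=> za i zi; move: za; rewrite zi map_f// mem_enum.
by [].
Qed.

Lemma continuous_quotient (P : {poly R[i]}) z : X z ->
  {for z, continuous (fun z : C => P.[z] / Q.[z] : C)}.
Proof.
rewrite punctured_planeE => Qz.
apply: (@continuous_atM _ C z (horner P : C -> C));
  first exact: continuous_horner_num.
apply: (@continuous_atV _ C z (horner Q : C -> C) Qz);
  exact: continuous_horner_num.
Qed.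

Lemma null_class_immersion :
  exists psi : C -> C * C,
    [/\ null_homotopy_class R X (CxCstar R) psi,
        proper_holomorphic_immersion X (CxCstar R) psi &
        countable (identified_pairs X psi)].
Proof.
have monQ := pole_poly_monic a; have sQ := size_pole_poly a;
  rewrite -/Q in monQ sQ.
pose P : {poly R[i]} := 'X * Q + 1.
have sP : size P = n.+2.
  rewrite /P mulrC size_polyDl size_mulX ?monic_neq0 ?sQ// size_poly1.
  by [].
exists (fun z : C => (P.[z] / Q.[z] : C, cexp z)); split.
- exists (0, 1); first by rewrite /CxCstar /= oner_neq0.
  apply: (@homotopic_CxCstar X (fun=> 0) (fun=> 1)) => [z _|z|].
  + exact: continuous_at_cst.
  + exact: continuous_quotient.
  + have u1 : unit_on X (fun=> 1 : C).
      by move=> z _; split; [exact: oner_neq0|exact: continuous_at_cst].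
    apply: (unit_homotopic_eq (unit_homotopic_cexp (g := id) u1 _)).
      by move=> z _; exact: cvg_id.
    by move=> z _; rewrite mul1r.
- apply: (@proper_holomorphic_immersion_quotient R X P Q cexp cexp).
  + by rewrite sP.
  + by rewrite sP sQ.
  + by move=> z Qz; rewrite /P !hornerE Qz mulr0 add0r oner_neq0.
  + exact: punctured_planeE.
  + by move=> z _; exact: cexp_neq0.
  + by move=> z _; exact: is_derive_cexp.
  + by move=> z _ e0; have := cexp_neq0 z; rewrite e0 eqxx.
pose c (m : int) : R[i] := (0 +i* (pi *+ 2)) *~ m.
(* Up to denominators, P/Q (x) - P/Q (x + c m): its roots contain the x of every pair whose
   difference is the period c m. *)
pose D m := P * (Q \Po ('X + (c m)%:P)) - (P \Po ('X + (c m)%:P)) * Q.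
apply: (@sub_countable _ _ _ (\bigcup_(m in [set m | c m != 0])
    (fun x : C => [set x; x + c m] : set C) @` [set x | (D m).[x] = 0])).
  apply: subset_card_le => _ [x [y [Xx Xy xy e ->]]].
  have /= pxy := congr1 fst e; have /= exy := congr1 snd e.
  have [m mE] : exists m : int, y - x = c m.
    by apply: cexp_eq1; rewrite cexpD cexpN exy mulfV// cexp_neq0.
  have yE : y = x + c m by rewrite -mE addrC subrK.
  exists m; first by rewrite /= -mE subr_eq0 eq_sym; apply/eqP.
  exists x; last by rewrite yE.
  have hc (p : {poly R[i]}) : (p \Po ('X + (c m)%:P)).[x] = p.[y].
    by rewrite horner_comp hornerD hornerX hornerC yE.
  rewrite /= /D hornerD hornerN !hornerM !hc.
  move: Xx Xy; rewrite punctured_planeE /= => Qx Qy.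
  by move/eqP: pxy; rewrite eqr_div// => /eqP ->; rewrite subrr.
apply: bigcup_countable; first exact: countableP.
move=> m cm; apply: finite_set_countable; apply: finite_image.
by apply: finite_roots; exact: translate_cross_neq0.
Qed.

Lemma essential_class_immersion (f : C -> C * C) : injective a ->
  continuous_map X (CxCstar R) f -> ~ null_homotopy_class R X (CxCstar R) f ->
  exists psi : C -> C * C,
    [/\ homotopy_class R X (CxCstar R) f psi,
        proper_holomorphic_immersion X (CxCstar R) psi &
        finite_set (identified_pairs X psi)].
Proof.
move=> ai [cf fY] nnull.
have monQ := pole_poly_monic a; have sQ := size_pole_poly a;
  rewrite -/Q in monQ sQ.
have oX : open X by rewrite punctured_plane_notin; exact: open_notin.
have cfX z : X z -> {for z, continuous f}.
  by move=> Xz; move: cf; rewrite continuous_open_subspace// => /(_ z); apply;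
    exact: mem_set.
have cf1 z : X z -> {for z, continuous (fun z => (f z).1)}.
  by move=> Xz; apply: (continuous_at_comp (cfX z Xz)); exact: cvg_fst.
have cf2 z : X z -> {for z, continuous (fun z => (f z).2)}.
  by move=> Xz; apply: (continuous_at_comp (cfX z Xz)); exact: cvg_snd.
have uf : unit_on X (fun z => (f z).2).
  by move=> z Xz; split; [exact: fY|exact: cf2].
have fE : f = (fun z => ((f z).1, (f z).2)) by apply/funext => z; case: (f z).
have us : uniq [seq a i | i <- enum 'I_n] by rewrite map_inj_uniq// enum_uniq.
have := uf; rewrite {1}punctured_plane_notin => /(unit_classification us)[k'].
rewrite -punctured_plane_notin => hom'.
pose k i := k' (a i).
have hom : unit_homotopic X (fun z => (f z).2) (fun z => \prod_i (z - a i) ^ k i).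
  by apply: (unit_homotopic_eq hom') => z _; rewrite big_map big_enum.
(* If all the exponents vanished, the product would be 1 and [hom] itself would show f to be
   null-homotopic. *)
have [i ki] : exists i, k i != 0.
  apply: contrapT => /forallNP k0; apply: nnull.
  exists (0, 1); first by rewrite /CxCstar /= oner_neq0.
  rewrite fE; apply: (@homotopic_CxCstar X (fun=> 0) (fun=> 1)) => [z _||].
  + exact: continuous_at_cst.
  + exact: cf1.
  + apply: unit_homotopic_sym; apply: (unit_homotopic_eq hom) => z _.
    by rewrite big1// => i _; have /negP/negPn/eqP -> := k0 i.
pose A : {poly R[i]} := num_poly a k; pose B : {poly R[i]} := den_poly a k.
have n0 : (0 < n)%N by case: (i) => m; case: (n).
have N0 : A^`() * B - A * B^`() != 0 by apply: wronskian_neq0 => //; exists i.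
have [P [sP PQ imm [d d0 dP]]] := generic_numerator n0 monQ sQ N0.
have Bn0 z : X z -> B.[z] != 0 by rewrite punctured_planeE; exact: den_poly_eq0.
exists (fun z : C => (P.[z] / Q.[z] : C, A.[z] / B.[z] : C)); split.
- rewrite /homotopy_class /= fE; apply: homotopic_CxCstar.
  + exact: cf1.
  + exact: continuous_quotient.
  + by apply: (unit_homotopic_eq hom) => z _; exact: prod_exprz.
- apply: (@proper_holomorphic_immersion_quotient R X P Q (fun z : C => A.[z] /
  B.[z] : C)
    (fun z : C => (A^`() * B - A * B^`()).[z] / B.[z] ^+ 2 : C)).
  + by rewrite sP.
  + by rewrite sP sQ.
  + exact: PQ.
  + exact: punctured_planeE.
  + move=> z Xz; rewrite mulf_neq0 ?invr_neq0 ?Bn0//; apply: num_poly_eq0.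
    by move: Xz; rewrite punctured_planeE.
  + by move=> z Xz; apply: is_derive_quotient; exact: Bn0.
  + move=> z Xz /eqP; rewrite mulf_eq0 invr_eq0 expf_eq0 (negbTE (Bn0 z Xz))
    andbF orbF.
    by move=> /eqP; apply: imm; move: Xz; rewrite punctured_planeE.
(* The equations of a double point are symmetric in x and y, so both members of an identified pair
   are roots of d. *)
pose S := [set z : C | d.[z] = 0].
have fS : finite_set S by exact: finite_roots.
apply: (@sub_finite_set _ _ ((fun p : C * C => [set p.1;
  p.2] : set C) @` (S `*` S))).
  move=> _ [x [y [Xx Xy xy e ->]]].
  have /= pxy := congr1 fst e; have /= rxy := congr1 snd e.
  have Bx := Bn0 x Xx; have By := Bn0 y Xy.
  move: Xx Xy; rewrite punctured_planeE /= => Qx Qy.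
  move/eqP: pxy; rewrite eqr_div// => /eqP pxy.
  move/eqP: rxy; rewrite eqr_div// => /eqP rxy.
  have xy' : x != y by apply/eqP.
  exists (x, y) => //; split; rewrite /S /=.
    by apply: (dP x y xy'); rewrite ?rxy ?pxy mulrC.
  apply: (dP y x); first by rewrite eq_sym.
    by rewrite -rxy mulrC.
  by rewrite -pxy mulrC.
by apply: finite_image; exact: finite_setX.
Qed.

End Assembly.

Theorem theorem1 (R : realType) (n : nat) (a : 'I_n -> Cplx R)
    (a_inj : injective a) :
  (exists psi : Cplx R -> Cplx R * Cplx R,
    [/\ null_homotopy_class R (punctured_plane a) (CxCstar R) psi,
        proper_holomorphic_immersion (punctured_plane a) (CxCstar R) psi &
        countable (identified_pairs (punctured_plane a) psi)]) /\
  (forall f : Cplx R -> Cplx R * Cplx R,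
    continuous_map (punctured_plane a) (CxCstar R) f ->
    ~ null_homotopy_class R (punctured_plane a) (CxCstar R) f ->
    exists psi : Cplx R -> Cplx R * Cplx R,
      [/\ homotopy_class R (punctured_plane a) (CxCstar R) f psi,
          proper_holomorphic_immersion (punctured_plane a) (CxCstar R) psi &
          finite_set (identified_pairs (punctured_plane a) psi)]).
Proof.
split; first exact: null_class_immersion.
by move=> f; exact: essential_class_immersion.
Qed.
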